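(* The following is provable in $\mathsf{RCA}_0$: every proper closed interval order is a proper distinguishing interval order.
   Context: $\mathsf{RCA}_0$ is the base subsystem of second-order arithmetic ($\Delta^0_1$ comprehension, $\Sigma^0_1$ induction). A partial order $\mathbf{P}=(P,\leq_P)$ is a set $P\subseteq\mathbb{N}$ with a reflexive, transitive, antisymmetric relation; a linear order has any two elements comparable; $p<_P q$ means $p\leq_P q$, $p\ne q$. Given a linear order $\mathbf{L}=(L,\leq_L)$ and $f_0,f_1:P\to L$ consider: (c1) $f_0(p)\leq_L f_1(p)$ for all $p$; (c2) $p<_P q$ iff $f_1(p)<_L f_0(q)$; (c4) $f_i(p)\ne f_j(q)$ whenever $p\ne q$ or $i\ne j$ ($i,j\in\{0,1\}$); (c5) $f_0(p)<_L f_0(q)$ iff $f_1(p)<_L f_1(q)$ for all $p,q$. $\mathbf{P}$ is a proper closed interval order if some $\mathbf{L},f_0,f_1$ satisfy (c1),(c2),(c5), and a proper distinguishing interval order if some $\mathbf{L},f_0,f_1$ satisfy (c1),(c2),(c4),(c5). *)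

(* Defs.v *)
From Stdlib Require Import List.
Import ListNotations.

(** * The language of second-order arithmetic

    De Bruijn indices, with two independent families of variables: [AllN]
    binds number variable 0 and leaves set indices alone, [AllS] binds set
    variable 0 and leaves number indices alone.  Equality is primitive only
    between numbers. *)

Inductive term : Type :=
| Var (n : nat)
| Zero
| One
| Plus (s t : term)
| Times (s t : term).

Inductive form : Type :=
| Eq (s t : term)
| Lt (s t : term)
| Mem (t : term) (X : nat)
| Bot
| Imp (A B : form)
| AllN (A : form)
| AllS (A : form).

Definition Not (A : form) : form := Imp A Bot.
Definition And (A B : form) : form := Not (Imp A (Not B)).
Definition Or (A B : form) : form := Imp (Not A) B.
Definition Iff (A B : form) : form := And (Imp A B) (Imp B A).
Definition ExN (A : form) : form := Not (AllN (Not A)).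
Definition ExS (A : form) : form := Not (AllS (Not A)).

Declare Scope form_scope.
Delimit Scope form_scope with form.
Bind Scope form_scope with form.
Notation "A && B" := (And A B) (at level 40, left associativity) : form_scope.
Notation "A || B" := (Or A B) (at level 50, left associativity) : form_scope.
Notation "A ==> B" := (Imp A B) (at level 55, right associativity) : form_scope.
Notation "A <==> B" := (Iff A B) (at level 56, no associativity) : form_scope.

Definition scons {T : Type} (x : T) (f : nat -> T) (n : nat) : T :=
  match n with
  | 0 => x
  | S m => f m
  end.

Fixpoint tsubst (sigma : nat -> term) (t : term) : term :=
  match t with
  | Var n => sigma n
  | Zero => Zero
  | One => One
  | Plus s t => Plus (tsubst sigma s) (tsubst sigma t)
  | Times s t => Times (tsubst sigma s) (tsubst sigma t)
  end.

Definition lift (t : term) : term := tsubst (fun n => Var (S n)) t.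

Definition upN (sigma : nat -> term) : nat -> term :=
  scons (Var 0) (fun n => lift (sigma n)).
Definition upS (rho : nat -> nat) : nat -> nat :=
  scons 0 (fun n => S (rho n)).

(** The only set terms are variables, so on the set side a substitution is a
    renaming. *)
Fixpoint subst (sigma : nat -> term) (rho : nat -> nat) (A : form) : form :=
  match A with
  | Eq s t => Eq (tsubst sigma s) (tsubst sigma t)
  | Lt s t => Lt (tsubst sigma s) (tsubst sigma t)
  | Mem t X => Mem (tsubst sigma t) (rho X)
  | Bot => Bot
  | Imp A B => Imp (subst sigma rho A) (subst sigma rho B)
  | AllN A => AllN (subst (upN sigma) rho A)
  | AllS A => AllS (subst sigma (upS rho) A)
  end.

Definition nshift (A : form) : form :=
  subst (fun n => Var (S n)) (fun X => X) A.
Definition sshift (A : form) : form := subst Var S A.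
Definition ninst (t : term) (A : form) : form :=
  subst (scons t Var) (fun X => X) A.
Definition sinst (X : nat) (A : form) : form :=
  subst Var (scons X (fun Y => Y)) A.

(** * Classical two-sorted natural deduction with equality

    The formulas of the theory [T] are read as universally closed: they are
    not shifted by the generalization rules, so their free variables may be
    generalized, whereas the free variables of the hypotheses [G] are fixed. *)

Inductive deriv (T : form -> Prop) : list form -> form -> Prop :=
| d_ax G A : T A -> deriv T G A
| d_hyp G A : In A G -> deriv T G A
| d_impI G A B : deriv T (A :: G) B -> deriv T G (Imp A B)
| d_impE G A B : deriv T G (Imp A B) -> deriv T G A -> deriv T G B
| d_raa G A : deriv T (Not A :: G) Bot -> deriv T G A
| d_allNI G A : deriv T (map nshift G) A -> deriv T G (AllN A)
| d_allNE G A t : deriv T G (AllN A) -> deriv T G (ninst t A)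
| d_allSI G A : deriv T (map sshift G) A -> deriv T G (AllS A)
| d_allSE G A X : deriv T G (AllS A) -> deriv T G (sinst X A)
| d_eqI G t : deriv T G (Eq t t)
| d_eqE G A s t :
    deriv T G (Eq s t) -> deriv T G (ninst s A) -> deriv T G (ninst t A).

Definition provable (T : form -> Prop) (A : form) : Prop := deriv T [] A.

(** * The axioms of RCA_0 *)

(** Writing [lift t] for the bound ensures that the bounded variable does not
    occur in it. *)
Inductive Delta0 : form -> Prop :=
| D0_eq s t : Delta0 (Eq s t)
| D0_lt s t : Delta0 (Lt s t)
| D0_mem t X : Delta0 (Mem t X)
| D0_bot : Delta0 Bot
| D0_imp A B : Delta0 A -> Delta0 B -> Delta0 (Imp A B)
| D0_all t A : Delta0 A -> Delta0 (AllN (Lt (Var 0) (lift t) ==> A))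
| D0_ex t A : Delta0 A -> Delta0 (ExN (Lt (Var 0) (lift t) && A)).

Inductive Sigma1 : form -> Prop :=
| Sigma1_intro A : Delta0 A -> Sigma1 (ExN A).

Inductive Pi1 : form -> Prop :=
| Pi1_intro A : Delta0 A -> Pi1 (AllN A).

Definition succ (t : term) : term := Plus t One.

Inductive RCA0 : form -> Prop :=
| ax_succ_neq0 : RCA0 (Not (Eq (succ (Var 0)) Zero))
| ax_succ_inj : RCA0 (Eq (succ (Var 0)) (succ (Var 1)) ==> Eq (Var 0) (Var 1))
| ax_add0 : RCA0 (Eq (Plus (Var 0) Zero) (Var 0))
| ax_addS :
    RCA0 (Eq (Plus (Var 0) (succ (Var 1))) (succ (Plus (Var 0) (Var 1))))
| ax_mul0 : RCA0 (Eq (Times (Var 0) Zero) Zero)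
| ax_mulS :
    RCA0 (Eq (Times (Var 0) (succ (Var 1)))
             (Plus (Times (Var 0) (Var 1)) (Var 0)))
| ax_lt0 : RCA0 (Not (Lt (Var 0) Zero))
| ax_ltS :
    RCA0 (Lt (Var 0) (succ (Var 1)) <==>
          (Lt (Var 0) (Var 1) || Eq (Var 0) (Var 1)))
(* The induction variable is number variable 0; the other free variables of
   [A] are parameters. *)
| ax_induction A :
    Sigma1 A ->
    RCA0 (ninst Zero A &&
          AllN (A ==>
                subst (scons (succ (Var 0)) (fun n => Var (S n)))
                      (fun X => X) A) ==>
          AllN A)
(* [sshift] makes room for the set being introduced, which therefore does not
   occur free in [A]. *)
| ax_comprehension A B :
    Sigma1 A -> Pi1 B ->
    RCA0 (AllN (A <==> B) ==>
          ExS (AllN (Mem (Var 0) 0 <==> sshift A))).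

(** * Orders and functions in second-order arithmetic

    [P], [R], [F], ... are indices of set variables; the formulas below bind
    no set variable, so these indices have the same meaning throughout. *)

(** The pairing (s,t) = (s+t)^2 + s, which is injective. *)
Definition tpair (s t : term) : term := Plus (Times (Plus s t) (Plus s t)) s.

Definition rel (R : nat) (s t : term) : form := Mem (tpair s t) R.

Definition allin (X : nat) (A : form) : form := AllN (Mem (Var 0) X ==> A).
Definition exin (X : nat) (A : form) : form := ExN (Mem (Var 0) X && A).

(** [R] is a subset of the product of [X] and [Y]. *)
Definition rel_between (X Y R : nat) : form :=
  AllN (Mem (Var 0) R ==>
        exin X (exin Y (Eq (Var 2) (tpair (Var 1) (Var 0))))).

Definition partial_order (P R : nat) : form :=
  rel_between P P R &&
  allin P (rel R (Var 0) (Var 0)) &&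
  allin P (allin P (allin P
    (rel R (Var 2) (Var 1) && rel R (Var 1) (Var 0) ==>
     rel R (Var 2) (Var 0)))) &&
  allin P (allin P
    (rel R (Var 1) (Var 0) && rel R (Var 0) (Var 1) ==>
     Eq (Var 1) (Var 0))).

Definition linear_order (L R : nat) : form :=
  partial_order L R &&
  allin L (allin L (rel R (Var 1) (Var 0) || rel R (Var 0) (Var 1))).

Definition strict (R : nat) (s t : term) : form :=
  rel R s t && Not (Eq s t).

Definition function (X Y F : nat) : form :=
  rel_between X Y F &&
  allin X (exin Y (rel F (Var 1) (Var 0))) &&
  allin X (allin Y (allin Y
    (rel F (Var 2) (Var 1) && rel F (Var 2) (Var 0) ==>
     Eq (Var 1) (Var 0)))).

(** For functions [F] and [G], [values F s G t A] says that [A] holds of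
    F(s), as number variable 1, and G(t), as number variable 0. *)
Definition values (F : nat) (s : term) (G : nat) (t : term) (A : form)
  : form :=
  ExN (ExN (rel F (lift (lift s)) (Var 1) &&
            rel G (lift (lift t)) (Var 0) && A)).

Definition val_le (S F : nat) (s : term) (G : nat) (t : term) : form :=
  values F s G t (rel S (Var 1) (Var 0)).
Definition val_lt (S F : nat) (s : term) (G : nat) (t : term) : form :=
  values F s G t (strict S (Var 1) (Var 0)).
Definition val_neq (F : nat) (s : term) (G : nat) (t : term) : form :=
  values F s G t (Not (Eq (Var 1) (Var 0))).

(** In [c1] to [c5], the partial order is ([P],[R]), the linear order has
    relation [S], and [F0], [F1] are the functions f_0, f_1. *)

Definition c1 (P S F0 F1 : nat) : form :=
  allin P (val_le S F0 (Var 0) F1 (Var 0)).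

Definition c2 (P R S F0 F1 : nat) : form :=
  allin P (allin P
    (strict R (Var 1) (Var 0) <==> val_lt S F1 (Var 1) F0 (Var 0))).

(** The four cases are the values of (i,j); for i <> j no condition on p and
    q remains. *)
Definition c4 (P F0 F1 : nat) : form :=
  allin P (allin P
    ((Not (Eq (Var 1) (Var 0)) ==> val_neq F0 (Var 1) F0 (Var 0)) &&
     (Not (Eq (Var 1) (Var 0)) ==> val_neq F1 (Var 1) F1 (Var 0)) &&
     val_neq F0 (Var 1) F1 (Var 0) &&
     val_neq F1 (Var 1) F0 (Var 0))).

Definition c5 (P S F0 F1 : nat) : form :=
  allin P (allin P
    (val_lt S F0 (Var 1) F0 (Var 0) <==> val_lt S F1 (Var 1) F1 (Var 0))).

(** The existential set quantifiers introduce, in order, L, its relation, f_0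
    and f_1, which get set indices 3, 2, 1 and 0. *)

Definition proper_closed_interval_order (P R : nat) : form :=
  let P := 4 + P in
  let R := 4 + R in
  ExS (ExS (ExS (ExS
    (linear_order 3 2 && function P 3 1 && function P 3 0 &&
     c1 P 2 1 0 && c2 P R 2 1 0 && c5 P 2 1 0)))).

Definition proper_distinguishing_interval_order (P R : nat) : form :=
  let P := 4 + P in
  let R := 4 + R in
  ExS (ExS (ExS (ExS
    (linear_order 3 2 && function P 3 1 && function P 3 0 &&
     c1 P 2 1 0 && c2 P R 2 1 0 && c4 P 1 0 && c5 P 2 1 0)))).

(* Main.v *)
(** The derivation is obtained semantically: by a Henkin argument the calculus
    is complete, so it suffices to prove the theorem in an arbitrary model of
    RCA_0.  Consistency is extended along finite contexts, which leave fresh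
    variables for the witnesses because axioms may be generalized over all
    their variables.

    In a model, the new linear order consists of the endpoints (p,0) and (p,1)
    for p in P, placed at f_0(p) and f_1(p) and compared first by position in
    L.  Endpoints at the same position are ordered with the left ones first,
    and those of the same kind by number.  Left before right preserves (c1) and
    (c2), and by (c5) f_0(p) = f_0(q) iff f_1(p) = f_1(q), so ties among left
    and among right endpoints are broken alike, which preserves (c5).  The
    order is Delta^0_1 because the values of the f_i are unique. *)

From Stdlib Require Import List Arith Lia Cantor Ring.
From Stdlib Require Import Classical ClassicalEpsilon FunctionalExtensionality
  PropExtensionality ProofIrrelevance.
Require Import Defs.
Import ListNotations.

(** Choice in the metatheory: it selects the Henkin stages and reads functions off graphs in a
    model. No choice principle is assumed inside the models. *)
Lemma choice {U V : Type} (Q : U -> V -> Prop) :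
  (forall x, exists y, Q x y) -> exists f, forall x, Q x (f x).
Proof.
  intros H.
  exists (fun x => proj1_sig (constructive_indefinite_description _ (H x))).
  intros x; apply proj2_sig.
Qed.

(** * Substitution *)

Lemma tsubst_id t : tsubst Var t = t.
Proof. induction t; cbn; congruence. Qed.

Lemma tsubst_comp sigma tau t :
  tsubst sigma (tsubst tau t) = tsubst (fun n => tsubst sigma (tau n)) t.
Proof. induction t; cbn; congruence. Qed.

Lemma upN_id : upN Var = Var.
Proof. extensionality n; now destruct n. Qed.

Lemma upS_id : upS (fun X => X) = fun X => X.
Proof. extensionality n; now destruct n. Qed.

Lemma upN_comp sigma tau :
  (fun n => tsubst (upN sigma) (upN tau n)) =
  upN (fun n => tsubst sigma (tau n)).
Proof.
  extensionality n; destruct n as [|n]; cbn; [reflexivity|].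
  unfold lift; now rewrite !tsubst_comp.
Qed.

Lemma upS_comp rho rho' :
  (fun X => upS rho (upS rho' X)) = upS (fun X => rho (rho' X)).
Proof. extensionality X; now destruct X. Qed.

Lemma subst_id A : subst Var (fun X => X) A = A.
Proof.
  induction A; cbn; rewrite ?tsubst_id, ?upN_id, ?upS_id; congruence.
Qed.

Lemma subst_comp sigma rho A : forall tau rho',
  subst sigma rho (subst tau rho' A) =
  subst (fun n => tsubst sigma (tau n)) (fun X => rho (rho' X)) A.
Proof.
  revert sigma rho; induction A; intros sigma rho tau rho'; cbn;
    rewrite ?tsubst_comp, ?IHA, ?IHA1, ?IHA2, ?upN_comp, ?upS_comp;
    reflexivity.
Qed.

Lemma subst_ninst sigma rho t A :
  subst sigma rho (ninst t A) = ninst (tsubst sigma t) (subst (upN sigma) rho A).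
Proof.
  unfold ninst; rewrite !subst_comp; f_equal; extensionality n.
  destruct n as [|n]; cbn; [reflexivity|].
  unfold lift; now rewrite tsubst_comp, tsubst_id.
Qed.

Lemma subst_sinst sigma rho X A :
  subst sigma rho (sinst X A) = sinst (rho X) (subst sigma (upS rho) A).
Proof.
  unfold sinst; rewrite !subst_comp; f_equal.
  - extensionality n; cbn; now rewrite tsubst_id.
  - extensionality Y; now destruct Y.
Qed.

Lemma subst_nshift sigma rho A :
  subst (upN sigma) rho (nshift A) = nshift (subst sigma rho A).
Proof. unfold nshift; now rewrite !subst_comp. Qed.

Lemma subst_sshift sigma rho A :
  subst sigma (upS rho) (sshift A) = sshift (subst sigma rho A).
Proof.
  unfold sshift; rewrite !subst_comp; f_equal.
  extensionality n; cbn; now rewrite tsubst_id.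
Qed.

Lemma ninst_upN t sigma rho A :
  ninst t (subst (upN sigma) rho A) = subst (scons t sigma) rho A.
Proof.
  unfold ninst; rewrite subst_comp; f_equal; extensionality n.
  destruct n as [|n]; cbn; [reflexivity|].
  unfold lift; now rewrite tsubst_comp, tsubst_id.
Qed.

Lemma sinst_upS X sigma rho A :
  sinst X (subst sigma (upS rho) A) = subst sigma (scons X rho) A.
Proof.
  unfold sinst; rewrite subst_comp; f_equal.
  - extensionality n; apply tsubst_id.
  - extensionality Y; now destruct Y.
Qed.

Lemma ninst_lift t s : tsubst (scons t Var) (lift s) = s.
Proof. unfold lift; now rewrite tsubst_comp, tsubst_id. Qed.

(** * Finite support of terms and formulas *)

Definition agree {U : Type} (k : nat) (f g : nat -> U) : Prop :=
  forall n, n < k -> f n = g n.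

Lemma tsubst_support t :
  exists k, forall sigma tau, agree k sigma tau -> tsubst sigma t = tsubst tau t.
Proof.
  induction t as [n| | |s [k IHs] t [l IHt]|s [k IHs] t [l IHt]];
    [exists (S n)|exists 0|exists 0|exists (k + l)|exists (k + l)];
    intros sigma tau H; cbn; try reflexivity; [apply H; lia| |];
    (rewrite (IHs sigma tau), (IHt sigma tau); [reflexivity| |];
     intros m Hm; apply H; lia).
Qed.

Lemma agree_upN k sigma tau : agree k sigma tau -> agree k (upN sigma) (upN tau).
Proof.
  intros H [|n] Hn; cbn; [reflexivity|]. rewrite (H n); [reflexivity|lia].
Qed.

Lemma agree_upS k rho rho' : agree k rho rho' -> agree k (upS rho) (upS rho').
Proof.
  intros H [|n] Hn; cbn; [reflexivity|]. rewrite (H n); [reflexivity|lia].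
Qed.

(** A substitution-theoretic way of saying that all free variables, of both sorts, have index below
    [k]. *)
Definition supported (k : nat) (A : form) : Prop :=
  forall sigma tau rho rho', agree k sigma tau -> agree k rho rho' ->
    subst sigma rho A = subst tau rho' A.

Lemma supported_le k l A : k <= l -> supported k A -> supported l A.
Proof.
  intros Hkl H sigma tau rho rho' Hs Hr; apply H;
    intros n Hn; [apply Hs|apply Hr]; lia.
Qed.

Lemma form_supported A : exists k, supported k A.
Proof.
  induction A as [s t|s t|t X| |A [k IHA] B [l IHB]|A [k IH]|A [k IH]].
  1,2: destruct (tsubst_support s) as [k Hk], (tsubst_support t) as [l Hl];
    exists (k + l); intros sigma tau rho rho' Hs Hr; cbn;
    rewrite (Hk sigma tau), (Hl sigma tau); [reflexivity| |];
    intros n Hn; apply Hs; lia.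
  - destruct (tsubst_support t) as [k Hk].
    exists (k + S X); intros sigma tau rho rho' Hs Hr; cbn.
    rewrite (Hk sigma tau), (Hr X); [reflexivity|lia|].
    intros n Hn; apply Hs; lia.
  - exists 0; intros sigma tau rho rho' _ _; reflexivity.
  - exists (k + l); intros sigma tau rho rho' Hs Hr; cbn.
    f_equal; [apply IHA|apply IHB]; intros n Hn; (apply Hs || apply Hr); lia.
  (* Only an upper bound is needed, so the bound for the body is kept, although one binder is
     gone. *)
  - exists k; intros sigma tau rho rho' Hs Hr; cbn.
    f_equal; apply IH; [now apply agree_upN|assumption].
  - exists k; intros sigma tau rho rho' Hs Hr; cbn.
    f_equal; apply IH; [assumption|now apply agree_upS].
Qed.

Lemma list_supported G : exists k, forall A, In A G -> supported k A.
Proof.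
  induction G as [|B G [k IH]]; [now exists 0|].
  destruct (form_supported B) as [l Hl].
  exists (k + l); intros A [<-|HA].
  - apply (supported_le l); [lia|assumption].
  - apply (supported_le k); [lia|auto].
Qed.

(** * Derivations *)

Section Derivations.
Variable T : form -> Prop.

Lemma deriv_weaken G A : deriv T G A -> forall G', incl G G' -> deriv T G' A.
Proof.
  induction 1; intros G' HG.
  - now apply d_ax.
  - apply d_hyp; auto.
  - apply d_impI, IHderiv. intros C [<-|HC]; [now left|right; auto].
  - eapply d_impE; eauto.
  - apply d_raa, IHderiv. intros C [<-|HC]; [now left|right; auto].
  - apply d_allNI, IHderiv, incl_map, HG.
  - apply d_allNE; auto.
  - apply d_allSI, IHderiv, incl_map, HG.
  - apply d_allSE; auto.
  - apply d_eqI.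
  - eapply d_eqE; eauto.
Qed.

Fixpoint prefix {U : Type} (k : nat) (f g : nat -> U) : nat -> U :=
  match k with
  | 0 => g
  | S k => scons (f 0) (prefix k (fun n => f (S n)) g)
  end.

Lemma agree_prefix {U : Type} k (f g : nat -> U) : agree k (prefix k f g) f.
Proof.
  revert f; induction k as [|k IH]; intros f n Hn; [lia|].
  destruct n as [|n]; cbn; [reflexivity|].
  apply (IH (fun m => f (S m))); lia.
Qed.

(** With no hypotheses, generalization is unrestricted: generalizing [k] times and then
    instantiating [k] times amounts to this simultaneous substitution. *)
Lemma provable_prefixN k sigma A :
  provable T A -> provable T (subst (prefix k sigma Var) (fun X => X) A).
Proof.
  revert sigma A; induction k as [|k IH]; intros sigma A HA; cbn.
  - now rewrite subst_id.
  - rewrite <- ninst_upN. apply d_allNE, (IH _ (AllN A)), d_allNI, HA.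
Qed.

Lemma provable_prefixS k rho A :
  provable T A -> provable T (subst Var (prefix k rho (fun X => X)) A).
Proof.
  revert rho A; induction k as [|k IH]; intros rho A HA; cbn.
  - now rewrite subst_id.
  - rewrite <- sinst_upS. apply d_allSE, (IH _ (AllS A)), d_allSI, HA.
Qed.

(** By finite support, only finitely many values of [sigma] and [rho] matter, and these are
    substituted by generalization and instantiation, numbers first. *)
Lemma provable_subst sigma rho A :
  provable T A -> provable T (subst sigma rho A).
Proof.
  intros HA. destruct (form_supported A) as [k Hk].
  assert (E : subst sigma rho A =
    subst (prefix k sigma Var) (prefix k rho (fun X => X)) A).
  { apply Hk; intros n Hn; symmetry; now apply agree_prefix. }
  rewrite E.
  replace (subst _ _ A) with
    (subst Var (prefix k rho (fun X => X))
       (subst (prefix k sigma Var) (fun X => X) A)).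
  - now apply provable_prefixS, provable_prefixN.
  - rewrite subst_comp; f_equal; extensionality n; apply tsubst_id.
Qed.

Lemma deriv_subst G A : deriv T G A -> forall sigma rho,
  deriv T (map (subst sigma rho) G) (subst sigma rho A).
Proof.
  induction 1; intros sigma rho.
  (* [T] need not be closed under substitution, but substitution instances of its axioms are
     provable without hypotheses. *)
  - apply deriv_weaken with (G := []); [|intros ? []].
    now apply provable_subst, d_ax.
  - now apply d_hyp, in_map.
  - apply d_impI, IHderiv.
  - eapply d_impE; [apply IHderiv1|apply IHderiv2].
  - apply d_raa, (IHderiv sigma rho).
  - apply d_allNI. specialize (IHderiv (upN sigma) rho).
    rewrite map_map in *.
    erewrite map_ext; [exact IHderiv|].
    intros B; symmetry; apply subst_nshift.
  - rewrite subst_ninst; apply d_allNE, IHderiv.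
  - apply d_allSI. specialize (IHderiv sigma (upS rho)).
    rewrite map_map in *.
    erewrite map_ext; [exact IHderiv|].
    intros B; symmetry; apply subst_sshift.
  - rewrite subst_sinst; apply d_allSE, IHderiv.
  - apply d_eqI.
  - rewrite subst_ninst in *. eapply d_eqE; [apply IHderiv1|].
    specialize (IHderiv2 sigma rho). now rewrite subst_ninst in IHderiv2.
Qed.

(** Take [x] above all free variables of [G] and [B]. Sending [x] to 0 and every other variable to
    its successor turns a derivation of the instance at [x] into the premise of [d_allNI]. *)
Lemma fresh_allN G B :
  exists x, deriv T G (ninst (Var x) B) -> deriv T G (AllN B).
Proof.
  destruct (list_supported (B :: G)) as [k Hk]. exists k; intros H.
  set (sigma := fun n => if n =? k then Var 0 else Var (S n)).
  assert (Hsig : agree k sigma (fun n => Var (S n))).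
  { intros n Hn; unfold sigma; destruct (Nat.eqb_spec n k); [lia|reflexivity]. }
  apply deriv_subst with (sigma := sigma) (rho := fun X => X) in H.
  apply d_allNI.
  replace (map nshift G) with (map (subst sigma (fun X => X)) G).
  2: { apply map_ext_in; intros A HA.
       apply (Hk A (or_intror HA)); [exact Hsig|now intros]. }
  replace B with (subst sigma (fun X => X) (ninst (Var k) B)); [exact H|].
  unfold ninst; rewrite subst_comp.
  transitivity (subst Var (fun X => X) B); [|apply subst_id].
  apply (Hk B (or_introl eq_refl)); [|now intros].
  intros [|n] Hn; cbn.
  - unfold sigma; now rewrite Nat.eqb_refl.
  - apply Hsig; lia.
Qed.

Lemma fresh_allS G B :
  exists X, deriv T G (sinst X B) -> deriv T G (AllS B).
Proof.
  destruct (list_supported (B :: G)) as [k Hk]. exists k; intros H.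
  set (rho := fun n => if n =? k then 0 else S n).
  assert (Hrho : agree k rho S).
  { intros n Hn; unfold rho; destruct (Nat.eqb_spec n k); [lia|reflexivity]. }
  apply deriv_subst with (sigma := Var) (rho := rho) in H.
  apply d_allSI.
  replace (map sshift G) with (map (subst Var rho) G).
  2: { apply map_ext_in; intros A HA.
       apply (Hk A (or_intror HA)); [now intros|exact Hrho]. }
  replace B with (subst Var rho (sinst k B)); [exact H|].
  unfold sinst; rewrite subst_comp.
  transitivity (subst Var (fun X => X) B); [|apply subst_id].
  apply (Hk B (or_introl eq_refl)); [now intros|].
  intros [|n] Hn; cbn.
  - unfold rho; now rewrite Nat.eqb_refl.
  - apply Hrho; lia.
Qed.

End Derivations.

(** * Henkin extensions *)

Fixpoint tcode (t : term) : nat :=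
  match t with
  | Var n => to_nat (0, n)
  | Zero => to_nat (1, 0)
  | One => to_nat (2, 0)
  | Plus s t => to_nat (3, to_nat (tcode s, tcode t))
  | Times s t => to_nat (4, to_nat (tcode s, tcode t))
  end.

Fixpoint fcode (A : form) : nat :=
  match A with
  | Eq s t => to_nat (0, to_nat (tcode s, tcode t))
  | Lt s t => to_nat (1, to_nat (tcode s, tcode t))
  | Mem t X => to_nat (2, to_nat (tcode t, X))
  | Bot => to_nat (3, 0)
  | Imp A B => to_nat (4, to_nat (fcode A, fcode B))
  | AllN A => to_nat (5, fcode A)
  | AllS A => to_nat (6, fcode A)
  end.

Lemma to_nat_inj a b c d : to_nat (a, b) = to_nat (c, d) -> a = c /\ b = d.
Proof.
  intros H; apply (f_equal of_nat) in H; rewrite !cancel_of_to in H.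
  now injection H.
Qed.

Lemma tcode_inj s : forall t, tcode s = tcode t -> s = t.
Proof.
  induction s; intros [] H; cbn [tcode] in H;
    apply to_nat_inj in H as [E H]; try discriminate E;
    try apply to_nat_inj in H as [H H']; f_equal; auto.
Qed.

Lemma fcode_inj A : forall B, fcode A = fcode B -> A = B.
Proof.
  induction A; intros [] H; cbn [fcode] in H;
    apply to_nat_inj in H as [E H]; try discriminate E;
    try apply to_nat_inj in H as [H H']; f_equal; auto using tcode_inj.
Qed.

(** Inverts the injective coding [fcode]; numbers that code no formula receive an arbitrary one. *)
Lemma form_enumeration : exists f : nat -> form, forall A, exists n, f n = A.
Proof.
  exists (fun n => epsilon (inhabits Bot) (fun A => fcode A = n)).
  intros A; exists (fcode A). apply fcode_inj.
  apply (epsilon_spec (inhabits Bot) (fun B => fcode B = fcode A)).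
  now exists A.
Qed.

Record henkin (T D : form -> Prop) : Prop := {
  h_deriv : forall G A, (forall B, In B G -> D B) -> deriv T G A -> D A;
  h_bot : ~ D Bot;
  h_not : forall A, ~ D A -> D (Not A);
  h_allN : forall B, D (Not (AllN B)) -> exists x, D (Not (ninst (Var x) B));
  h_allS : forall B, D (Not (AllS B)) -> exists X, D (Not (sinst X B))
}.

Section Henkin.
Variable T : form -> Prop.

Definition consistent (G : list form) : Prop := ~ deriv T G Bot.

(** One Henkin stage: [A] is accepted if it is consistent with [G], and a negated universal formula
    is accepted together with a counterexample. *)
Definition extends_by (G : list form) (A : form) (G' : list form) : Prop :=
  incl G G' /\ consistent G' /\
  (consistent (A :: G) ->
   In A G' /\
   (forall B, A = Not (AllN B) -> exists x, In (Not (ninst (Var x) B)) G') /\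
   (forall B, A = Not (AllS B) -> exists X, In (Not (sinst X B)) G')).

Lemma extension_step G A : consistent G -> exists G', extends_by G A G'.
Proof.
  intros HG. destruct (classic (consistent (A :: G))) as [HA|HA].
  2: { exists G; split; [apply incl_refl|]; now split. }
  assert (Hincl : incl G (A :: G)) by apply incl_tl, incl_refl.
  destruct (classic (exists B, A = Not (AllN B))) as [[B ->]|HN].
  - destruct (fresh_allN T (Not (AllN B) :: G) B) as [x Hx].
    exists (Not (ninst (Var x) B) :: Not (AllN B) :: G).
    split; [now apply incl_tl|split].
    (* If the counterexample led to a contradiction, [d_raa] would give the instance at the fresh
       [x], hence [AllN B], against its negation. *)
    + intros H; apply HA.
      eapply d_impE; [apply d_hyp; now left|]. now apply Hx, d_raa.
    + intros _; split; [cbn; auto|split].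
      * intros B' E; injection E as <-; exists x; now left.
      * intros B' E; discriminate E.
  - destruct (classic (exists B, A = Not (AllS B))) as [[B ->]|HS].
    + destruct (fresh_allS T (Not (AllS B) :: G) B) as [X HX].
      exists (Not (sinst X B) :: Not (AllS B) :: G).
      split; [now apply incl_tl|split].
      * intros H; apply HA.
        eapply d_impE; [apply d_hyp; now left|]. now apply HX, d_raa.
      * intros _; split; [cbn; auto|split].
        -- intros B' E; discriminate E.
        -- intros B' E; injection E as <-; exists X; now left.
    + exists (A :: G). split; [assumption|split; [assumption|]].
      intros _; split; [now left|split]; intros B ->; exfalso; eauto.
Qed.

Lemma henkin_extension G0 : consistent G0 ->
  exists D, henkin T D /\ forall A, In A G0 -> D A.
Proof.
  intros HG0. destruct form_enumeration as [f Hf].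
  (* Consistency is moved under the existential to make the relation total, as [choice] requires. *)
  assert (Hnext : forall GA : list form * form, exists G',
    consistent (fst GA) -> extends_by (fst GA) (snd GA) G').
  { intros [G A]. destruct (classic (consistent G)) as [HG|HG].
    - destruct (extension_step G A HG) as [G' H]; eauto.
    - exists G; tauto. }
  apply choice in Hnext as [next Hnext].
  assert (next_spec : forall G A, consistent G -> extends_by G A (next (G, A)))
    by (intros G A; apply (Hnext (G, A))).
  pose (stage := fix stage n :=
    match n with 0 => G0 | S n => next (stage n, f n) end).
  assert (Hcon : forall n, consistent (stage n)).
  { induction n as [|n IH]; [exact HG0|]. now apply next_spec. }
  assert (Hmono : forall m n, m <= n -> incl (stage m) (stage n)).
  { induction 1 as [|n _ IH]; [apply incl_refl|].
    eapply incl_tran; [exact IH|]. now apply next_spec. }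
  (* Taking what the stages derive, not just their union, makes [D] deductively closed: finitely
     many premises are derivable at a common stage. *)
  set (D := fun A => exists n, deriv T (stage n) A).
  assert (HD : forall G A, (forall B, In B G -> D B) -> deriv T G A -> D A).
  { induction G as [|B G IH]; intros A HG HA.
    - exists 0. eapply deriv_weaken; [exact HA|intros ? []].
    - destruct (IH (Imp B A)) as [m Hm].
      + intros C HC; apply HG; now right.
      + now apply d_impI.
      + destruct (HG B (or_introl eq_refl)) as [n Hn].
        exists (m + n). eapply d_impE; eapply deriv_weaken.
        * exact Hm.
        * apply Hmono; lia.
        * exact Hn.
        * apply Hmono; lia. }
  assert (Hbot : ~ D Bot) by (intros [n Hn]; exact (Hcon n Hn)).
  assert (Hin : forall n A, In A (stage n) -> D A).
  { intros n A HA; exists n; now apply d_hyp. }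
  assert (Hstep : forall n, D (f n) -> consistent (f n :: stage n)).
  { intros n Hn H. apply Hbot. apply (HD (f n :: stage n)); [|exact H].
    intros B [<-|HB]; eauto. }
  exists D; split; [split|intros A; exact (Hin 0 A)].
  - exact HD.
  - exact Hbot.
  - intros A HA. destruct (Hf A) as [n <-].
    (* Stage [n] must refute [f n], since otherwise the next stage would contain it. *)
    exists n. apply d_impI. apply NNPP; intros H. apply HA, (Hin (S n)).
    now apply (next_spec (stage n) (f n) (Hcon n)).
  - intros B HB. destruct (Hf (Not (AllN B))) as [n Hn].
    destruct (next_spec (stage n) (f n) (Hcon n)) as (_ & _ & H).
    destruct H as (_ & H & _); [apply Hstep; now rewrite Hn|].
    destruct (H B Hn) as [x Hx]. exists x; now apply (Hin (S n)).
  - intros B HB. destruct (Hf (Not (AllS B))) as [n Hn].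
    destruct (next_spec (stage n) (f n) (Hcon n)) as (_ & _ & H).
    destruct H as (_ & _ & H); [apply Hstep; now rewrite Hn|].
    destruct (H B Hn) as [X HX]. exists X; now apply (Hin (S n)).
Qed.

End Henkin.

(** * Models and completeness *)

Record model : Type := {
  num : Type;
  sets : Type;
  zero : num;
  one : num;
  add : num -> num -> num;
  mul : num -> num -> num;
  lt : num -> num -> Prop;
  mem : num -> sets -> Prop
}.

Fixpoint teval (M : model) (e : nat -> num M) (t : term) : num M :=
  match t with
  | Var n => e n
  | Zero => zero M
  | One => one M
  | Plus s t => add M (teval M e s) (teval M e t)
  | Times s t => mul M (teval M e s) (teval M e t)
  end.

Fixpoint sat (M : model) (e : nat -> num M) (r : nat -> sets M) (A : form)
  : Prop :=
  match A with
  | Eq s t => teval M e s = teval M e t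
  | Lt s t => lt M (teval M e s) (teval M e t)
  | Mem t X => mem M (teval M e t) (r X)
  | Bot => False
  | Imp A B => sat M e r A -> sat M e r B
  | AllN A => forall x, sat M (scons x e) r A
  | AllS A => forall X, sat M e (scons X r) A
  end.

Definition models (M : model) (T : form -> Prop) : Prop :=
  forall A, T A -> forall e r, sat M e r A.

(** * The term model of a Henkin theory *)

Section TermModel.
Variables T D : form -> Prop.
Hypothesis HD : henkin T D.

Lemma D_impE A B : D (Imp A B) -> D A -> D B.
Proof.
  intros HAB HA. apply (h_deriv _ _ HD [Imp A B; A]).
  - now intros C [<-|[<-|[]]].
  - eapply d_impE; apply d_hyp; cbn; auto.
Qed.

Lemma D_imp A B : D (Imp A B) <-> (D A -> D B).
Proof.
  split; [apply D_impE|]. intros H.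
  destruct (classic (D A)) as [HA|HA].
  - apply (h_deriv _ _ HD [B]); [intros C [<-|[]]; auto|].
    apply d_impI, d_hyp; cbn; auto.
  - apply (h_deriv _ _ HD [Not A]).
    + intros C [<-|[]]; now apply (h_not _ _ HD).
    + apply d_impI, d_raa, d_impE with A; apply d_hyp; cbn; auto.
Qed.

Lemma D_allN B : D (AllN B) <-> forall t, D (ninst t B).
Proof.
  split.
  - intros H t. apply (h_deriv _ _ HD [AllN B]); [now intros C [<-|[]]|].
    apply d_allNE, d_hyp; cbn; auto.
  - intros H. apply NNPP; intros HN.
    apply (h_not _ _ HD), (h_allN _ _ HD) in HN as [x Hx].
    apply (h_bot _ _ HD), (D_impE _ _ Hx), H.
Qed.

Lemma D_allS B : D (AllS B) <-> forall X, D (sinst X B).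
Proof.
  split.
  - intros H X. apply (h_deriv _ _ HD [AllS B]); [now intros C [<-|[]]|].
    apply d_allSE, d_hyp; cbn; auto.
  - intros H. apply NNPP; intros HN.
    apply (h_not _ _ HD), (h_allS _ _ HD) in HN as [X HX].
    apply (h_bot _ _ HD), (D_impE _ _ HX), H.
Qed.

Lemma D_eqI t : D (Eq t t).
Proof. apply (h_deriv _ _ HD []); [intros C []|apply d_eqI]. Qed.

Lemma D_eqE A s t : D (Eq s t) -> D (ninst s A) -> D (ninst t A).
Proof.
  intros HE HA. apply (h_deriv _ _ HD [Eq s t; ninst s A]).
  - now intros C [<-|[<-|[]]].
  - apply d_eqE with (s := s); apply d_hyp; cbn; auto.
Qed.

Lemma D_eqC s t : D (Eq s t) -> D (Eq t s).
Proof.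
  intros H. generalize (D_eqE (Eq (Var 0) (lift s)) s t H).
  cbn; rewrite !ninst_lift. intros K; apply K, D_eqI.
Qed.

Lemma D_eq_trans s t u : D (Eq s t) -> D (Eq t u) -> D (Eq s u).
Proof.
  intros H H'. generalize (D_eqE (Eq (lift s) (Var 0)) t u H').
  cbn; rewrite !ninst_lift. auto.
Qed.

(** Provably equal terms define the same predicate, by extensionality, so [epsilon] picks the same
    representative for them. The fixed points of [rep] thus serve as the quotient of the terms by
    equality in [D]. *)
Definition rep (t : term) : term :=
  epsilon (inhabits Zero) (fun s => D (Eq t s)).

Lemma rep_eq t : D (Eq t (rep t)).
Proof.
  apply (epsilon_spec (inhabits Zero) (fun s => D (Eq t s))).
  exists t; apply D_eqI.
Qed.

Lemma rep_ext s t : rep s = rep t <-> D (Eq s t).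
Proof.
  split; intros H.
  - apply D_eq_trans with (rep s); [apply rep_eq|].
    rewrite H; apply D_eqC, rep_eq.
  - unfold rep; f_equal; extensionality u; apply propositional_extensionality.
    split; apply D_eq_trans; [now apply D_eqC|assumption].
Qed.

Definition cls_num : Type := {t : term | rep t = t}.

Definition cls (t : term) : cls_num :=
  exist _ (rep t) (proj2 (rep_ext (rep t) t) (D_eqC _ _ (rep_eq t))).

Definition val (c : cls_num) : term := proj1_sig c.

Lemma cls_eq s t : cls s = cls t <-> D (Eq s t).
Proof.
  rewrite <- rep_ext; split; intros H.
  - exact (f_equal val H).
  - apply eq_sig_hprop; [intros; apply proof_irrelevance|exact H].
Qed.

Lemma val_cls t : D (Eq t (val (cls t))).
Proof. apply rep_eq. Qed.

Lemma cls_val c : cls (val c) = c.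
Proof.
  destruct c as [t Ht].
  apply eq_sig_hprop; [intros; apply proof_irrelevance|exact Ht].
Qed.

Definition term_model : model := {|
  num := cls_num;
  sets := nat;
  zero := cls Zero;
  one := cls One;
  add a b := cls (Plus (val a) (val b));
  mul a b := cls (Times (val a) (val b));
  lt a b := D (Lt (val a) (val b));
  mem a X := D (Mem (val a) X)
|}.

(** Leibniz's rule is applied to one argument at a time; commutation of [f] with substitution lets
    the two lifted sides be instantiated. *)
Lemma D_congr_term (f : term -> term -> term) s s' t t' :
  (forall sigma u v, tsubst sigma (f u v) = f (tsubst sigma u) (tsubst sigma v)) ->
  D (Eq s s') -> D (Eq t t') -> D (Eq (f s t) (f s' t')).
Proof.
  intros Hf Hs Ht.
  generalize (D_eqE (Eq (lift (f s t)) (f (Var 0) (lift t))) s s' Hs).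
  generalize (D_eqE (Eq (lift (f s t)) (f (lift s') (Var 0))) t t' Ht).
  cbn; rewrite !Hf, !ninst_lift. cbn. auto using D_eqI.
Qed.

Lemma D_congr_form (c : term -> term -> form) s s' t t' :
  (forall sigma u v, subst sigma (fun X => X) (c u v) =
     c (tsubst sigma u) (tsubst sigma v)) ->
  D (Eq s s') -> D (Eq t t') -> D (c s t) <-> D (c s' t').
Proof.
  intros Hc.
  assert (K : forall s s' t t', D (Eq s s') -> D (Eq t t') -> D (c s t) -> D (c s' t')).
  { clear s s' t t'; intros s s' t t' Hs Ht.
    generalize (D_eqE (c (Var 0) (lift t)) s s' Hs).
    generalize (D_eqE (c (lift s') (Var 0)) t t' Ht).
    unfold ninst; rewrite !Hc, !ninst_lift. auto. }
  intros Hs Ht; split; apply K; auto using D_eqC.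
Qed.

Lemma teval_term_model sigma t :
  teval term_model (fun n => cls (sigma n)) t = cls (tsubst sigma t).
Proof.
  induction t as [n| | |s IHs t IHt|s IHs t IHt]; cbn; try reflexivity;
    rewrite IHs, IHt; apply cls_eq, D_eqC.
  - apply (D_congr_term Plus); auto using val_cls.
  - apply (D_congr_term Times); auto using val_cls.
Qed.

Lemma scons_cls t sigma :
  scons (cls t) (fun n => cls (sigma n)) = fun n => cls (scons t sigma n).
Proof. extensionality n; now destruct n. Qed.

(** The truth lemma. An assignment by classes is a substitution of terms, and the quantifier cases
    work because every number is the class of a term and every set is a variable. *)
Lemma sat_term_model A : forall sigma rho,
  sat term_model (fun n => cls (sigma n)) rho A <-> D (subst sigma rho A).
Proof.
  induction A as [s t|s t|t X| |A IHA B IHB|A IH|A IH]; intros sigma rho;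
    cbn [sat subst]; rewrite ?teval_term_model.
  - apply cls_eq.
  - symmetry; apply (D_congr_form Lt); auto using val_cls.
  (* Membership has a single term argument; [Zero] fills the dummy second place. *)
  - symmetry; apply (D_congr_form (fun t _ => Mem t (rho X)) _ _ Zero Zero);
      auto using val_cls, D_eqI.
  - split; [intros []|apply (h_bot _ _ HD)].
  - rewrite D_imp, IHA, IHB. reflexivity.
  - rewrite D_allN. split; intros H.
    + intros t. specialize (H (cls t)). rewrite scons_cls, IH in H.
      now rewrite ninst_upN.
    + intros x. rewrite <- (cls_val x), scons_cls, IH, <- ninst_upN. apply H.
  - rewrite D_allS. split; intros H X; specialize (H X).
    + rewrite sinst_upS. now apply IH.
    + rewrite sinst_upS in H. now apply IH.
Qed.

Lemma term_model_models : models term_model T.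
Proof.
  intros A HA e r.
  replace e with (fun n => cls (val (e n)))
    by (extensionality n; apply cls_val).
  apply sat_term_model.
  apply (h_deriv _ _ HD []); [intros B []|].
  now apply provable_subst, d_ax.
Qed.

End TermModel.

(** If [A] is unprovable, [Not A] is consistent by [d_raa], and the term model of a Henkin extension
    refutes [A] under the assignment of each variable to its own class. *)
Theorem completeness T A :
  (forall M, models M T -> forall e r, sat M e r A) -> provable T A.
Proof.
  intros H. apply NNPP; intros HA.
  destruct (henkin_extension T [Not A]) as [D [HD HDA]].
  { intros HB; now apply HA, d_raa. }
  apply (h_bot _ _ HD), (D_impE T D HD A); [apply HDA; now left|].
  rewrite <- subst_id. apply (sat_term_model T D HD).
  apply H, term_model_models.
Qed.

(** * Satisfaction *)

Section Satisfaction.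
Variable M : model.

Lemma teval_tsubst e sigma t :
  teval M e (tsubst sigma t) = teval M (fun n => teval M e (sigma n)) t.
Proof. induction t; cbn; congruence. Qed.

Lemma teval_lift e x t : teval M (scons x e) (lift t) = teval M e t.
Proof. apply teval_tsubst. Qed.

Lemma sat_subst A : forall e r sigma rho,
  sat M e r (subst sigma rho A) <->
  sat M (fun n => teval M e (sigma n)) (fun X => r (rho X)) A.
Proof.
  induction A as [s t|s t|t X| |A IHA B IHB|A IH|A IH]; intros e r sigma rho;
    cbn; rewrite ?teval_tsubst; try reflexivity.
  - rewrite IHA, IHB; reflexivity.
  - assert (E : forall x, (fun n => teval M (scons x e) (upN sigma n)) =
        scons x (fun n => teval M e (sigma n))).
    { intros x; extensionality n; destruct n; [reflexivity|apply teval_lift]. }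
    split; intros H x; specialize (H x); [rewrite IH, E in H|rewrite IH, E]; exact H.
  - assert (E : forall X, (fun n => scons X r (upS rho n)) =
        scons X (fun n => r (rho n))).
    { intros X; extensionality n; now destruct n. }
    split; intros H X; specialize (H X); [rewrite IH, E in H|rewrite IH, E]; exact H.
Qed.

Lemma sat_nshift e r x A : sat M (scons x e) r (nshift A) <-> sat M e r A.
Proof. unfold nshift; rewrite sat_subst; reflexivity. Qed.

Lemma sat_sshift e r X A : sat M e (scons X r) (sshift A) <-> sat M e r A.
Proof. unfold sshift; rewrite sat_subst; reflexivity. Qed.

Lemma sat_ninst e r t A :
  sat M e r (ninst t A) <-> sat M (scons (teval M e t) e) r A.
Proof.
  unfold ninst; rewrite sat_subst.
  replace (fun n => _) with (scons (teval M e t) e); [reflexivity|].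
  extensionality n; now destruct n.
Qed.

Lemma sat_And e r A B : sat M e r (A && B) <-> sat M e r A /\ sat M e r B.
Proof. cbn; tauto. Qed.

Lemma sat_Iff e r A B : sat M e r (A <==> B) <-> (sat M e r A <-> sat M e r B).
Proof. cbn; tauto. Qed.

Lemma sat_ExN e r A : sat M e r (ExN A) <-> exists x, sat M (scons x e) r A.
Proof. cbn; split; [apply not_all_not_ex|firstorder]. Qed.

Lemma sat_ExS e r A : sat M e r (ExS A) <-> exists X, sat M e (scons X r) A.
Proof. cbn; split; [apply not_all_not_ex|firstorder]. Qed.

(* The defined connectives are read back as the connectives of Rocq; [sat]
   would give their negative translations.  The cases with a compound
   antecedent keep [And A B ==> C] and [ExN A ==> C] from being read as
   disjunctions. *)
Definition sem_step (sem : (nat -> num M) -> (nat -> sets M) -> form -> Prop)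
  (e : nat -> num M) (r : nat -> sets M) (A : form) : Prop :=
  match A with
  | Eq s t => teval M e s = teval M e t
  | Lt s t => lt M (teval M e s) (teval M e t)
  | Mem t X => mem M (teval M e t) (r X)
  | Bot => False
  | Imp (Imp A (Imp B Bot)) Bot => sem e r A /\ sem e r B
  | Imp (AllN (Imp A Bot)) Bot => exists x, sem (scons x e) r A
  | Imp (AllS (Imp A Bot)) Bot => exists X, sem e (scons X r) A
  | Imp (Imp (AllN _) Bot as A) B => sem e r A -> sem e r B
  | Imp (Imp (AllS _) Bot as A) B => sem e r A -> sem e r B
  | Imp (Imp (Imp _ (Imp _ Bot)) Bot as A) B => sem e r A -> sem e r B
  | Imp (Imp A Bot) B => sem e r A \/ sem e r B
  | Imp A B => sem e r A -> sem e r B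
  | AllN A => forall x, sem (scons x e) r A
  | AllS A => forall X, sem e (scons X r) A
  end.

Fixpoint sem (e : nat -> num M) (r : nat -> sets M) (A : form) {struct A}
  : Prop := sem_step sem e r A.

Lemma sem_eq e r A : sem e r A = sem_step sem e r A.
Proof. destruct A; reflexivity. Qed.

Fixpoint size (A : form) : nat :=
  match A with
  | Imp A B => S (size A + size B)
  | AllN A | AllS A => S (size A)
  | _ => 0
  end.

(** A clause of [sem] may strip several connectives at once, so the induction is on [size] and not
    on the structure of [A]. *)
Lemma sat_sem A : forall e r, sat M e r A <-> sem e r A.
Proof.
  induction A as [A IH] using (induction_ltof1 _ size); unfold ltof in IH.
  intros e r; rewrite sem_eq.
  destruct A as [s t|s t|t X| |A B|A|A]; try reflexivity; unfold sem_step.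
  - pose proof (IH A ltac:(cbn; lia) e r) as HA.
    pose proof (IH B ltac:(cbn; lia) e r) as HB.
    (* Splits exactly the subformulas on which the pattern matching of [sem_step] is stuck. *)
    repeat match goal with
    | |- context [match ?X with Eq _ _ => _ | Lt _ _ => _ | Mem _ _ => _
        | Bot => _ | Imp _ _ => _ | AllN _ => _ | AllS _ => _ end] =>
        is_var X; destruct X
    end;
    try (cbn [sat]; rewrite <- HA, <- HB; reflexivity);
    repeat match goal with
    | |- context [sem e r ?X] => rewrite <- (IH X) by (cbn; lia)
    end;
    first [cbn [sat]; tauto|refine (iff_trans (sat_ExN _ _ _) _)
      |refine (iff_trans (sat_ExS _ _ _) _)];
    (split; intros [x Hx]; exists x;
      [refine (proj1 (IH _ _ _ _) Hx)|refine (proj2 (IH _ _ _ _) Hx)]; cbn; lia).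
  - split; intros H x; apply IH, H; cbn; lia.
  - split; intros H X; apply IH, H; cbn; lia.
Qed.

End Satisfaction.

(** * Linear orders *)

Definition strict_rel {U : Type} (R : U -> U -> Prop) (x y : U) : Prop :=
  R x y /\ x <> y.

Record linear_on {U : Type} (X : U -> Prop) (R : U -> U -> Prop) : Prop := {
  lin_refl : forall x, X x -> R x x;
  lin_trans : forall x y z, X x -> X y -> X z -> R x y -> R y z -> R x z;
  lin_antisym : forall x y, X x -> X y -> R x y -> R y x -> x = y;
  lin_total : forall x y, X x -> X y -> R x y \/ R y x
}.

Lemma linear_on_ext {U : Type} (X : U -> Prop) R R' :
  (forall x y, X x -> X y -> R' x y <-> R x y) -> linear_on X R -> linear_on X R'.
Proof.
  intros E H; split; intros.
  - apply E, (lin_refl _ _ H); auto.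
  - rewrite E in * by assumption. eapply (lin_trans _ _ H) with y; auto.
  - rewrite E in * by assumption. apply (lin_antisym _ _ H); auto.
  - rewrite !E by assumption. apply (lin_total _ _ H); auto.
Qed.

Lemma linear_on_subset {U : Type} (X Y : U -> Prop) R :
  (forall x, Y x -> X x) -> linear_on X R -> linear_on Y R.
Proof.
  intros E H; split; intros.
  - apply (lin_refl _ _ H); auto.
  - eapply (lin_trans _ _ H) with y; auto.
  - apply (lin_antisym _ _ H); auto.
  - apply (lin_total _ _ H); auto.
Qed.

(** Gives linearity of the refined order, with [h] the position of an endpoint in L and [T] the
    order that breaks ties. *)
Lemma lexicographic_linear {U V : Type} (X : U -> Prop) (Y : V -> Prop) h S T :
  linear_on Y S -> (forall x, X x -> Y (h x)) -> linear_on X T ->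
  linear_on X (fun x y => strict_rel S (h x) (h y) \/ h x = h y /\ T x y).
Proof.
  intros HS Hh HT; unfold strict_rel; split.
  - intros x Hx; right; split; [reflexivity|now apply (lin_refl _ _ HT)].
  - intros x y z Hx Hy Hz [[Hxy Nxy]|[Exy Hxy]] [[Hyz Nyz]|[Eyz Hyz]].
    + left; split; [now apply (lin_trans _ _ HS) with (h y); auto|].
      intros E; rewrite E in *. apply Nyz, (lin_antisym _ _ HS); auto.
    + rewrite Eyz in *; auto.
    + rewrite Exy in *; auto.
    + right; split; [congruence|now apply (lin_trans _ _ HT) with y].
  - intros x y Hx Hy [[Hxy Nxy]|[Exy Hxy]] [[Hyx Nyx]|[Eyx Hyx]]; try congruence.
    + destruct Nxy; apply (lin_antisym _ _ HS); auto.
    + now apply (lin_antisym _ _ HT).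
  - intros x y Hx Hy. destruct (classic (h x = h y)) as [E|N].
    + rewrite E; destruct (lin_total _ _ HT x y Hx Hy); auto.
    + destruct (lin_total _ _ HS (h x) (h y)); auto.
Qed.

(** * Arithmetic in models of RCA_0 *)

Lemma Delta0_subst A : Delta0 A ->
  forall sigma rho, Delta0 (subst sigma rho A).
Proof.
  assert (K : forall sigma t, tsubst (upN sigma) (lift t) = lift (tsubst sigma t)).
  { intros sigma t; unfold lift; now rewrite !tsubst_comp. }
  induction 1; intros sigma rho; cbn; try (constructor; auto; fail).
  - rewrite K; now apply D0_all.
  - rewrite K; apply (D0_ex _ (subst (upN sigma) rho A)); auto.
Qed.

Lemma Delta0_not A : Delta0 A -> Delta0 (Not A).
Proof. intros H; apply D0_imp; [exact H|apply D0_bot]. Qed.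

Lemma Delta0_and A B : Delta0 A -> Delta0 B -> Delta0 (A && B).
Proof. intros HA HB; now apply Delta0_not, D0_imp, Delta0_not. Qed.

Lemma Delta0_or A B : Delta0 A -> Delta0 B -> Delta0 (A || B).
Proof. intros HA HB; apply D0_imp; [now apply Delta0_not|exact HB]. Qed.

Definition ex_le (t : term) (A : form) : form :=
  ExN (Lt (Var 0) (lift (succ t)) && A).

Lemma Delta0_ex_le t A : Delta0 A -> Delta0 (ex_le t A).
Proof. apply D0_ex. Qed.

Section Arithmetic.
Variable M : model.
Hypothesis HM : models M RCA0.
(** Satisfaction is relative to an assignment of sets even for purely arithmetical axioms, so some
    assignment is fixed. *)
Variable r : nat -> sets M.

Notation "0" := (zero M).
Notation "1" := (one M).
Infix "+" := (add M).
Infix "*" := (mul M).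
Infix "<" := (lt M).

Lemma RCA0_sem A : RCA0 A -> forall e r, sem M e r A.
Proof. intros HA e r'. apply sat_sem, HM, HA. Qed.

Definition env2 (x y : num M) : nat -> num M := scons x (fun _ => y).

Lemma succ_neq0 x : x + 1 <> 0.
Proof. exact (RCA0_sem _ ax_succ_neq0 (env2 x x) r). Qed.

Lemma succ_inj x y : x + 1 = y + 1 -> x = y.
Proof. exact (RCA0_sem _ ax_succ_inj (env2 x y) r). Qed.

Lemma add_0_r x : x + 0 = x.
Proof. exact (RCA0_sem _ ax_add0 (env2 x x) r). Qed.

Lemma add_succ_r x y : x + (y + 1) = x + y + 1.
Proof. exact (RCA0_sem _ ax_addS (env2 x y) r). Qed.

Lemma mul_0_r x : x * 0 = 0.
Proof. exact (RCA0_sem _ ax_mul0 (env2 x x) r). Qed.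

Lemma mul_succ_r x y : x * (y + 1) = x * y + x.
Proof. exact (RCA0_sem _ ax_mulS (env2 x y) r). Qed.

Lemma lt_0_r x : ~ x < 0.
Proof. exact (RCA0_sem _ ax_lt0 (env2 x x) r). Qed.

Lemma lt_succ_r x y : x < y + 1 <-> x < y \/ x = y.
Proof. exact (RCA0_sem _ ax_ltS (env2 x y) r). Qed.

Lemma Sigma1_induction A e r' : Delta0 A ->
  (exists w, sat M (scons w (scons 0 e)) r' A) ->
  (forall x, (exists w, sat M (scons w (scons x e)) r' A) ->
     exists w, sat M (scons w (scons (x + 1) e)) r' A) ->
  forall x, exists w, sat M (scons w (scons x e)) r' A.
Proof.
  intros HA H0 HS x.
  generalize (HM _ (ax_induction _ (Sigma1_intro _ HA)) e r').
  cbn [sat]; rewrite sat_And, sat_ninst; intros K.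
  rewrite <- sat_ExN; revert x; apply K; split; [now apply sat_ExN|].
  intros x Hx. rewrite sat_ExN in Hx. apply sat_subst.
  replace (fun n => _) with (scons (x + 1) e)
    by (extensionality n; now destruct n).
  now apply sat_ExN, HS.
Qed.

(** A vacuous existential quantifier makes the formula Sigma1; 0 is the dummy witness. *)
Lemma Delta0_induction A e r' : Delta0 A ->
  sat M (scons 0 e) r' A ->
  (forall x, sat M (scons x e) r' A -> sat M (scons (x + 1) e) r' A) ->
  forall x, sat M (scons x e) r' A.
Proof.
  intros HA H0 HS x.
  destruct (Sigma1_induction (nshift A) e r') with (x := x) as [w Hw].
  - now apply Delta0_subst.
  - exists 0; now apply sat_nshift.
  - intros y [w Hw]; exists 0; apply sat_nshift, HS.
    now apply sat_nshift in Hw.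
  - now apply sat_nshift in Hw.
Qed.

(* [A] is quantifier-free; [x], [y], [z] are its number variables 0, 1, 2. *)
Ltac induct A x y z :=
  refine (Delta0_induction A (env2 y z) r _ _ _ x);
  [repeat constructor|cbn|intros n; cbn; intros IH].

(** * The semiring laws *)

Lemma add_0_l x : 0 + x = x.
Proof.
  induct (Eq (Plus Zero (Var 0)) (Var 0)) x x x.
  - apply add_0_r.
  - now rewrite add_succ_r, IH.
Qed.

Lemma add_succ_l x y : x + 1 + y = x + y + 1.
Proof.
  induct (Eq (Plus (succ (Var 1)) (Var 0)) (succ (Plus (Var 1) (Var 0)))) y x x.
  - now rewrite !add_0_r.
  - now rewrite !add_succ_r, IH.
Qed.

Lemma add_comm x y : x + y = y + x.
Proof.
  induct (Eq (Plus (Var 1) (Var 0)) (Plus (Var 0) (Var 1))) y x x.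
  - now rewrite add_0_r, add_0_l.
  - now rewrite add_succ_r, add_succ_l, IH.
Qed.

Lemma add_assoc x y z : x + (y + z) = x + y + z.
Proof.
  induct (Eq (Plus (Var 1) (Plus (Var 2) (Var 0)))
    (Plus (Plus (Var 1) (Var 2)) (Var 0))) z x y.
  - now rewrite !add_0_r.
  - now rewrite !add_succ_r, IH.
Qed.

Lemma mul_0_l x : 0 * x = 0.
Proof.
  induct (Eq (Times Zero (Var 0)) Zero) x x x.
  - apply mul_0_r.
  - now rewrite mul_succ_r, IH, add_0_r.
Qed.

Lemma mul_succ_l x y : (x + 1) * y = x * y + y.
Proof.
  induct (Eq (Times (succ (Var 1)) (Var 0))
    (Plus (Times (Var 1) (Var 0)) (Var 0))) y x x.
  - now rewrite !mul_0_r, add_0_r.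
  - rewrite !mul_succ_r, IH, <- !add_assoc. f_equal.
    now rewrite !add_assoc, (add_comm n x).
Qed.

Lemma mul_comm x y : x * y = y * x.
Proof.
  induct (Eq (Times (Var 1) (Var 0)) (Times (Var 0) (Var 1))) y x x.
  - now rewrite mul_0_r, mul_0_l.
  - now rewrite mul_succ_r, mul_succ_l, IH.
Qed.

Lemma mul_1_l x : 1 * x = x.
Proof. now rewrite <- (add_0_l 1), mul_succ_l, mul_0_l, add_0_l. Qed.

Lemma mul_add_distr_r x y z : (x + y) * z = x * z + y * z.
Proof.
  induct (Eq (Times (Plus (Var 1) (Var 2)) (Var 0))
    (Plus (Times (Var 1) (Var 0)) (Times (Var 2) (Var 0)))) z x y.
  - now rewrite !mul_0_r, add_0_r.
  - rewrite !mul_succ_r, IH, <- !add_assoc. f_equal.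
    now rewrite !add_assoc, (add_comm x).
Qed.

Lemma mul_assoc x y z : x * (y * z) = x * y * z.
Proof.
  induct (Eq (Times (Var 1) (Times (Var 2) (Var 0)))
    (Times (Times (Var 1) (Var 2)) (Var 0))) z x y.
  - now rewrite !mul_0_r.
  - now rewrite !mul_succ_r, mul_comm, mul_add_distr_r, !(mul_comm _ x), IH.
Qed.

Lemma num_semi_ring : semi_ring_theory 0 1 (add M) (mul M) eq.
Proof.
  constructor.
  - apply add_0_l.
  - apply add_comm.
  - apply add_assoc.
  - apply mul_1_l.
  - apply mul_0_l.
  - apply mul_comm.
  - apply mul_assoc.
  - apply mul_add_distr_r.
Qed.

Add Ring num_ring : num_semi_ring.

(** * Cancellation and the order of the numbers *)

Lemma add_cancel_r x y z : x + z = y + z -> x = y.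
Proof.
  induct (Eq (Plus (Var 1) (Var 0)) (Plus (Var 2) (Var 0)) ==>
    Eq (Var 1) (Var 2))%form z x y.
  - now rewrite !add_0_r.
  - rewrite !add_succ_r; intros H; now apply IH, succ_inj.
Qed.

Lemma zero_or_succ x : x = 0 \/ exists y, x = y + 1.
Proof.
  assert (H : exists y, x = 0 \/ x = y + 1).
  { destruct (Sigma1_induction
      (Eq (Var 1) Zero || Eq (Var 1) (succ (Var 0)))%form (env2 x x) r)
      with (x := x) as [y Hy].
    - repeat constructor.
    - exists 0; apply sat_sem; now left.
    - intros y _; exists y; apply sat_sem; now right.
    - apply sat_sem in Hy; now exists y. }
  destruct H as [y [H|H]]; [now left|right; eauto].
Qed.

(** Both differences share one witness [d] in front of the disjunction, which makes the statement
    Sigma1 and so allows induction on [x]. *)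
Lemma trichotomy x y :
  x = y \/ (exists d, y = x + d + 1) \/ (exists d, x = y + d + 1).
Proof.
  assert (H : exists d, (x = y \/ y = x + d + 1) \/ x = y + d + 1).
  { destruct (Sigma1_induction
      ((Eq (Var 1) (Var 2) || Eq (Var 2) (succ (Plus (Var 1) (Var 0)))) ||
        Eq (Var 1) (succ (Plus (Var 2) (Var 0))))%form (env2 y y) r)
      with (x := x) as [d Hd].
    - repeat constructor.
    - destruct (zero_or_succ y) as [->|[d ->]].
      + exists 0; apply sat_sem; now left; left.
      + exists d; apply sat_sem; left; right; cbn; ring.
    - intros z [d Hd]. apply sat_sem in Hd; cbn in Hd.
      destruct Hd as [[->| ->]| ->].
      + exists 0; apply sat_sem; right; cbn; ring.
      + destruct (zero_or_succ d) as [->|[c ->]].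
        * exists 0; apply sat_sem; left; left; cbn; ring.
        * exists c; apply sat_sem; left; right; cbn; ring.
      + exists (d + 1); apply sat_sem; right; cbn; ring.
    - apply sat_sem in Hd; now exists d. }
  destruct H as [d [[H|H]|H]]; eauto.
Qed.

(** Reduces the order to addition, so that inequalities become identities for [ring]. *)
Lemma lt_iff x y : x < y <-> exists d, y = x + d + 1.
Proof.
  split.
  (* The quantifier precedes the implication to obtain a Sigma1 formula; where the hypothesis fails,
     0 is the default witness. *)
  - assert (H : exists d, x < y -> y = x + d + 1).
    { destruct (Sigma1_induction
        (Lt (Var 2) (Var 1) ==> Eq (Var 1) (succ (Plus (Var 2) (Var 0))))%form
        (env2 x x) r) with (x := y) as [d Hd].
      - repeat constructor.
      - exists 0; cbn; intros H; now apply lt_0_r in H.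
      - intros z [d Hd]; cbn in *.
        destruct (classic (x < z)) as [H|H].
        + exists (d + 1); intros _; rewrite (Hd H); ring.
        + exists 0; rewrite lt_succ_r; intros [K| ->]; [tauto|ring].
      - now exists d. }
    destruct H as [d H]; eauto.
  - intros [d ->].
    induct (Lt (Var 1) (succ (Plus (Var 1) (Var 0)))) d x x; apply lt_succ_r.
    + right; ring.
    + left; now rewrite add_assoc.
Qed.

Lemma add_succ_neq x d : x + d + 1 <> x.
Proof.
  intros H. apply (succ_neq0 d), (add_cancel_r _ _ x).
  transitivity (x + d + 1); [ring|rewrite H; ring].
Qed.

Lemma lt_irrefl x : ~ x < x.
Proof. rewrite lt_iff; intros [d H]; now apply (add_succ_neq x d). Qed.

Lemma lt_trans x y z : x < y -> y < z -> x < z.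
Proof.
  rewrite !lt_iff; intros [c ->] [d ->]. exists (c + d + 1); ring.
Qed.

Lemma lt_total x y : x < y \/ x = y \/ y < x.
Proof. rewrite !lt_iff; destruct (trichotomy x y) as [H|[H|H]]; auto. Qed.

(** * The pairing function in a model *)

Definition pair (x y : num M) : num M := (x + y) * (x + y) + x.

(** The code determines the sum $s = x + y$, because $s^2 + x < (s+1)^2$. For equal sums,
    cancellation gives [x] and then [y]. *)
Lemma pair_inj x y x' y' : pair x y = pair x' y' -> x = x' /\ y = y'.
Proof.
  assert (K : forall x y x' y' d, x' + y' = x + y + d + 1 ->
    pair x y <> pair x' y').
  { clear x y x' y'; intros x y x' y' d E H. unfold pair in H; rewrite E in H.
    set (s := x + y) in *.
    (* Cancelling $s^2$ from $s^2 + x = (s+d+1)^2 + x'$ makes [x] equal to [x] plus this amount plus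
       1. *)
    apply (add_succ_neq x (y + s * d + d * s + s + d * d + d + d + x')).
    apply (add_cancel_r _ _ (s * s)).
    rewrite (add_comm x (s * s)), H.
    replace (x + (y + s * d + d * s + s + d * d + d + d + x'))
      with (s + (s * d + d * s + s + d * d + d + d + x')) by (unfold s; ring).
    ring. }
  intros H. destruct (trichotomy (x + y) (x' + y')) as [E|[[d E]|[d E]]].
  - unfold pair in H; rewrite E, !(add_comm (_ * _)) in H.
    apply add_cancel_r in H as ->. split; [reflexivity|].
    rewrite !(add_comm x') in E. now apply add_cancel_r in E.
  - now apply (K _ _ _ _ d) in H.
  - symmetry in H; now apply (K _ _ _ _ d) in H.
Qed.

Lemma lt_succ_pair_l x y : x < pair x y + 1.
Proof. apply lt_iff; exists ((x + y) * (x + y)); unfold pair; ring. Qed.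

Lemma lt_succ_pair_r x y : y < pair x y + 1.
Proof.
  apply lt_iff. destruct (zero_or_succ y) as [->|[z ->]].
  - exists (pair x 0); ring.
  - exists (x * x + (1 + 1) * x * z + (1 + 1 + 1) * x + z * z + z); unfold pair; ring.
Qed.


(** * Comprehension *)

Lemma Delta1_comprehension A B e r' : Delta0 A -> Delta0 B ->
  (forall x, (exists w, sat M (scons w (scons x e)) r' A) <->
     forall w, sat M (scons w (scons x e)) r' B) ->
  exists Z, forall x, mem M x Z <-> exists w, sat M (scons w (scons x e)) r' A.
Proof.
  intros HA HB H.
  generalize (HM _ (ax_comprehension _ _ (Sigma1_intro _ HA) (Pi1_intro _ HB)) e r').
  intros K; cbn [sat] in K; rewrite sat_ExS in K.
  destruct K as [Z HZ].
  - intros x; rewrite sat_Iff, sat_ExN; apply H.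
  - exists Z; intros x. generalize (HZ x); cbn [sat].
    now rewrite sat_Iff, sat_sshift, sat_ExN.
Qed.

Lemma sat_ex_le e r' t A :
  sat M e r' (ex_le t A) <->
  exists x, x < teval M e t + 1 /\ sat M (scons x e) r' A.
Proof.
  unfold ex_le; rewrite sat_ExN.
  split; intros [x Hx]; exists x; rewrite sat_And in *;
    cbn [sat] in *; rewrite teval_lift in *; exact Hx.
Qed.

(** Components are at most their code, so decoding needs only bounded quantifiers. [Var 1], [Var 2]
    and [Var 3] all denote the code, under zero, one and two new binders. *)
Definition ex_pair (A : form) : form :=
  ex_le (Var 1) (ex_le (Var 2) (Eq (Var 3) (tpair (Var 1) (Var 0)) && A)).

Lemma sat_ex_pair e r' w z A :
  sat M (scons w (scons z e)) r' (ex_pair A) <->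
  exists x y, z = pair x y /\ sat M (scons y (scons x (scons w (scons z e)))) r' A.
Proof.
  unfold ex_pair; rewrite sat_ex_le; setoid_rewrite sat_ex_le.
  setoid_rewrite sat_And. split.
  - intros (x & _ & y & _ & H). now exists x, y.
  - intros (x & y & E & H). exists x; split.
    + cbn; rewrite E; apply lt_succ_pair_l.
    + exists y; split; [|now split].
      cbn; rewrite E; apply lt_succ_pair_r.
Qed.

Lemma Delta0_ex_pair A : Delta0 A -> Delta0 (ex_pair A).
Proof. intros H; apply Delta0_ex_le, Delta0_ex_le, Delta0_and; [constructor|exact H]. Qed.

(* The number variables 0, 1, 2, 3 of [A] and [B] are [y], [x], the witness
   [w] and the code of the pair [(x, y)]. *)
Lemma relation_comprehension (Q : num M -> num M -> Prop) A B r' :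
  Delta0 A -> Delta0 B ->
  (forall x y z e, Q x y <->
     exists w, sat M (scons y (scons x (scons w (scons z e)))) r' A) ->
  (forall x y z e, Q x y <->
     forall w, sat M (scons y (scons x (scons w (scons z e)))) r' B) ->
  exists Z, forall z, mem M z Z <-> exists x y, z = pair x y /\ Q x y.
Proof.
  intros HA HB HQA HQB.
  destruct (Delta1_comprehension (ex_pair A) (ex_pair B) (fun _ => 0) r')
    as [Z HZ]; try now apply Delta0_ex_pair.
  - intros z; split.
    + intros [w H] v. apply sat_ex_pair in H as (x & y & E & H).
      apply sat_ex_pair. exists x, y; split; [exact E|].
      apply HQB, (HQA x y z (fun _ => 0)); eauto.
    (* The instance at 0 only shows that [z] is a pair; injectivity of pairing then identifies its
       components in all other instances. *)
    + intros H. generalize (H 0); rewrite sat_ex_pair; intros (x & y & E & _).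
      setoid_rewrite sat_ex_pair.
      cut (Q x y); [rewrite (HQA x y z (fun _ => 0)); firstorder|].
      apply (HQB x y z (fun _ => 0)); intros w.
      generalize (H w); rewrite sat_ex_pair; intros (x' & y' & E' & K).
      rewrite E in E'; apply pair_inj in E' as [<- <-]; exact K.
  - exists Z; intros z; rewrite HZ; setoid_rewrite sat_ex_pair; split.
    + intros (w & x & y & E & H). exists x, y; split; [exact E|].
      apply (HQA x y z (fun _ => 0)); eauto.
    + intros (x & y & E & H).
      apply (HQA x y z (fun _ => 0)) in H as [w H]. eauto 6.
Qed.

Definition rel_mem (Z : sets M) (x y : num M) : Prop := mem M (pair x y) Z.

Lemma rel_mem_pair (Q : num M -> num M -> Prop) Z :
  (forall z, mem M z Z <-> exists x y, z = pair x y /\ Q x y) ->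
  forall x y, rel_mem Z x y <-> Q x y.
Proof.
  intros HZ x y; unfold rel_mem; rewrite HZ; split.
  - intros (x' & y' & E & H). now apply pair_inj in E as [<- <-].
  - intros H; now exists x, y.
Qed.

(** * Orders and functions in models *)

(** This predicate and those below copy the shape that [sem] gives to the corresponding formulas,
    down to the nesting of conjunctions, so that the equivalences hold by [reflexivity]. *)
Definition is_between (X Y F : sets M) : Prop :=
  forall z, mem M z F ->
    exists x, mem M x X /\ exists y, mem M y Y /\ z = pair x y.

Definition is_linear_order (L S : sets M) : Prop :=
  (((is_between L L S /\
     (forall x, mem M x L -> rel_mem S x x)) /\
    (forall x, mem M x L -> forall y, mem M y L -> forall z, mem M z L ->
       rel_mem S x y /\ rel_mem S y z -> rel_mem S x z)) /\
   (forall x, mem M x L -> forall y, mem M y L ->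
      rel_mem S x y /\ rel_mem S y x -> x = y)) /\
  (forall x, mem M x L -> forall y, mem M y L -> rel_mem S x y \/ rel_mem S y x).

Definition is_function (X Y F : sets M) : Prop :=
  (is_between X Y F /\
   (forall x, mem M x X -> exists y, mem M y Y /\ rel_mem F x y)) /\
  (forall x, mem M x X -> forall y, mem M y Y -> forall y', mem M y' Y ->
     rel_mem F x y /\ rel_mem F x y' -> y = y').

Definition at_values (F : sets M) (x : num M) (G : sets M) (y : num M)
  (Q : num M -> num M -> Prop) : Prop :=
  exists u v, (rel_mem F x u /\ rel_mem G y v) /\ Q u v.

Definition is_c1 (P S F0 F1 : sets M) : Prop :=
  forall p, mem M p P -> at_values F0 p F1 p (rel_mem S).

Definition is_c2 (P R S F0 F1 : sets M) : Prop :=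
  forall p, mem M p P -> forall q, mem M q P ->
    strict_rel (rel_mem R) p q <-> at_values F1 p F0 q (strict_rel (rel_mem S)).

(** The disjunctions with [p = q] are what [sem] makes of implications from a negated equation. *)
Definition is_c4 (P F0 F1 : sets M) : Prop :=
  forall p, mem M p P -> forall q, mem M q P ->
    (((p = q \/ at_values F0 p F0 q (fun u v => u <> v)) /\
      (p = q \/ at_values F1 p F1 q (fun u v => u <> v))) /\
     at_values F0 p F1 q (fun u v => u <> v)) /\
    at_values F1 p F0 q (fun u v => u <> v).

Definition is_c5 (P S F0 F1 : sets M) : Prop :=
  forall p, mem M p P -> forall q, mem M q P ->
    at_values F0 p F0 q (strict_rel (rel_mem S)) <->
    at_values F1 p F1 q (strict_rel (rel_mem S)).

Section Sat.
Variables (e : nat -> num M) (s : nat -> sets M).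

Lemma sat_linear_order L S :
  sat M e s (linear_order L S) <-> is_linear_order (s L) (s S).
Proof. rewrite sat_sem; reflexivity. Qed.

Lemma sat_function X Y F :
  sat M e s (function X Y F) <-> is_function (s X) (s Y) (s F).
Proof. rewrite sat_sem; reflexivity. Qed.

Lemma sat_c1 P S F0 F1 : sat M e s (c1 P S F0 F1) <-> is_c1 (s P) (s S) (s F0) (s F1).
Proof. rewrite sat_sem; reflexivity. Qed.

Lemma sat_c2 P R S F0 F1 :
  sat M e s (c2 P R S F0 F1) <-> is_c2 (s P) (s R) (s S) (s F0) (s F1).
Proof. rewrite sat_sem; reflexivity. Qed.

Lemma sat_c4 P F0 F1 : sat M e s (c4 P F0 F1) <-> is_c4 (s P) (s F0) (s F1).
Proof. rewrite sat_sem; reflexivity. Qed.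

Lemma sat_c5 P S F0 F1 : sat M e s (c5 P S F0 F1) <-> is_c5 (s P) (s S) (s F0) (s F1).
Proof. rewrite sat_sem; reflexivity. Qed.

End Sat.

Lemma is_linear_order_iff L S :
  is_linear_order L S <->
  is_between L L S /\ linear_on (fun x => mem M x L) (rel_mem S).
Proof.
  split.
  - intros [[[[HB Hr] Ht] Ha] Hl]. split; [exact HB|split]; auto.
    + intros x y z Hx Hy Hz Hxy Hyz. apply (Ht x Hx y Hy z Hz); auto.
  - intros [HB [Hr Ht Ha Hl]]. repeat split; auto.
    + intros x Hx y Hy z Hz [Hxy Hyz]; eauto.
    + intros x Hx y Hy [Hxy Hyx]; auto.
Qed.

Lemma is_function_graph X Y F : is_function X Y F ->
  exists f, forall x, mem M x X ->
    mem M (f x) Y /\ forall y, rel_mem F x y <-> y = f x.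
Proof.
  intros [[HB Hex] Huniq].
  assert (H : forall x, exists y, mem M x X ->
    mem M y Y /\ forall y', rel_mem F x y' <-> y' = y).
  { intros x. destruct (classic (mem M x X)) as [Hx|Hx]; [|now exists x].
    destruct (Hex x Hx) as (y & Hy & Hxy). exists y; intros _; split; [exact Hy|].
    intros y'; split; [|now intros ->]. intros Hxy'.
    (* Uniqueness is assumed only for values in [Y]; that [F] lies in the product places [y']
       there. *)
    destruct (HB _ Hxy') as (x1 & _ & y1 & Hy1 & E).
    apply pair_inj in E as [<- <-]. eapply Huniq; eauto. }
  apply choice in H as [f Hf]. exists f; exact Hf.
Qed.

Lemma graph_is_function (X Y F : sets M) (f : num M -> num M) :
  (forall x, mem M x X -> mem M (f x) Y) ->
  (forall z, mem M z F <-> exists x y, z = pair x y /\ (mem M x X /\ y = f x)) ->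
  is_function X Y F.
Proof.
  intros Hf HF. assert (HF' := rel_mem_pair _ _ HF). split; [split|].
  - intros z Hz. apply HF in Hz as (x & y & -> & Hx & ->). eauto 6.
  - intros x Hx. exists (f x). rewrite HF'; auto.
  - intros x Hx y _ y' _. rewrite !HF'. intros [[_ ->] [_ ->]]; reflexivity.
Qed.

Lemma at_values_iff F x G y Q u v :
  (forall u', rel_mem F x u' <-> u' = u) ->
  (forall v', rel_mem G y v' <-> v' = v) ->
  at_values F x G y Q <-> Q u v.
Proof.
  intros HF HG; unfold at_values; setoid_rewrite HF; setoid_rewrite HG. split.
  - intros (u' & v' & [-> ->] & H); exact H.
  - intros H; now exists u, v.
Qed.

(** The same formula serves as the Sigma1 and the Pi1 definition; the witness variable is absorbed
    into the arbitrary [e]. *)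
Lemma Delta0_relation (Q : num M -> num M -> Prop) A r' : Delta0 A ->
  (forall x y e, Q x y <-> sat M (scons y (scons x e)) r' A) ->
  exists Z, forall z, mem M z Z <-> exists x y, z = pair x y /\ Q x y.
Proof.
  intros HA HQ.
  apply (relation_comprehension Q A A r'); auto; intros x y z e.
  - split; [intros H; exists 0; now apply HQ|].
    intros [w H]; now apply HQ in H.
  - split; [intros H w; now apply HQ|].
    intros H; specialize (H 0); now apply HQ in H.
Qed.

(** * Endpoints and the refined order *)

Lemma one_neq_zero : 1 <> 0.
Proof. rewrite <- (add_0_l 1); apply succ_neq0. Qed.

Lemma pair_lt_mono_l p q b : p < q -> pair p b < pair q b.
Proof.
  rewrite !lt_iff; intros [d ->].
  exists ((1 + 1) * (p + b) * (d + 1) + (d + 1) * (d + 1) + d); unfold pair; ring.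
Qed.

(** Allows endpoints of one kind to be compared through their codes. *)
Lemma pair_lt_iff p q b : pair p b < pair q b <-> p < q.
Proof.
  split; [|apply pair_lt_mono_l]. intros H.
  destruct (lt_total p q) as [K|[->|K]]; [exact K| |].
  - now apply lt_irrefl in H.
  - apply (pair_lt_mono_l _ _ b) in K. now destruct (lt_irrefl _ (lt_trans _ _ _ H K)).
Qed.

(** The order that breaks ties: [~ n < m] means $m \le n$, and the two implications say that both
    endpoints are of the same kind. The wording is that of [sem] on the defining formula. *)
Definition endpoint_le (Left : num M -> Prop) (m n : num M) : Prop :=
  Left m /\ ~ Left n \/ ((Left m -> Left n) /\ (Left n -> Left m)) /\ ~ n < m.

Lemma endpoint_le_linear Left : linear_on (fun _ => True) (endpoint_le Left).
Proof.
  unfold endpoint_le; split.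
  - intros x _. generalize (lt_irrefl x); tauto.
  - intros x y z _ _ _.
    assert (z < x -> z < y \/ y < x).
    { destruct (lt_total z y) as [K|[->|K]]; auto.
      intros H; right; exact (lt_trans _ _ _ K H). }
    tauto.
  - intros x y _ _. destruct (lt_total x y) as [K|[K|K]]; tauto.
  - intros x y _ _.
    assert (x < y -> ~ y < x).
    { intros H K; exact (lt_irrefl _ (lt_trans _ _ _ H K)). }
    tauto.
Qed.

Section Refinement.
Variables P S F0 F1 : sets M.

Lemma left_endpoints : exists Z, forall z,
  mem M z Z <-> exists p b, z = pair p b /\ (mem M p P /\ b = 0).
Proof.
  apply (Delta0_relation _ (Mem (Var 1) 0 && Eq (Var 0) Zero)%form (fun _ => P)).
  - repeat constructor.
  - intros x y e; rewrite sat_sem; reflexivity.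
Qed.

Lemma endpoints : exists Z, forall z,
  mem M z Z <-> exists p b, z = pair p b /\ (mem M p P /\ (b = 0 \/ b = 1)).
Proof.
  apply (Delta0_relation _ (Mem (Var 1) 0 && (Eq (Var 0) Zero || Eq (Var 0) One))%form
    (fun _ => P)).
  - repeat constructor.
  - intros x y e; rewrite sat_sem; reflexivity.
Qed.

Lemma endpoint_map (t : term) b : (forall e, teval M e t = b) ->
  exists G, forall z,
  mem M z G <-> exists p y, z = pair p y /\ (mem M p P /\ y = pair p b).
Proof.
  intros Ht.
  apply (Delta0_relation _ (Mem (Var 1) 0 && Eq (Var 0) (tpair (Var 1) t))%form
    (fun _ => P)).
  - repeat constructor.
  - intros x y e; rewrite sat_sem; cbn; rewrite Ht; reflexivity.
Qed.

(** Joins [F0] and [F1] into one position relation on endpoints. The bound on [p] excludes nothing,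
    a component being at most its code, and keeps the definition Delta0. *)
Lemma endpoint_position : exists H, forall m u, rel_mem H m u <->
  (exists p, p < m + 1 /\ (m = pair p 0 /\ rel_mem F0 p u)) \/
  (exists p, p < m + 1 /\ (m = pair p 1 /\ rel_mem F1 p u)).
Proof.
  eapply ex_ind; [|apply (Delta0_relation
    (fun m u => (exists p, p < m + 1 /\ (m = pair p 0 /\ rel_mem F0 p u)) \/
       (exists p, p < m + 1 /\ (m = pair p 1 /\ rel_mem F1 p u)))
    (ex_le (Var 1) (Eq (Var 2) (tpair (Var 0) Zero) && rel 0 (Var 0) (Var 1)) ||
     ex_le (Var 1) (Eq (Var 2) (tpair (Var 0) One) && rel 1 (Var 0) (Var 1)))%form
    (scons F0 (fun _ => F1)))].
  - intros H HH; exists H. exact (rel_mem_pair _ _ HH).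
  - apply Delta0_or; apply Delta0_ex_le; repeat constructor.
  - intros x y e; rewrite sat_sem; reflexivity.
Qed.

(** Positions are not bounded by the endpoints, so [w] bounds them. The Sigma1 form says that some
    [w] admits positions in the right order, the Pi1 form that no [w] admits positions violating it.
    They agree because each endpoint has exactly one position. *)
Lemma refined_order L' H Z (h : num M -> num M) :
  (forall m, mem M m L' -> forall u, rel_mem H m u <-> u = h m) ->
  exists S', forall z, mem M z S' <-> exists m n, z = pair m n /\
    ((mem M m L' /\ mem M n L') /\
     (strict_rel (rel_mem S) (h m) (h n) \/
      h m = h n /\ endpoint_le (fun x => mem M x Z) m n)).
Proof.
  intros Hh.
  (* Inside [A], variables 0 to 4 are the position of [n], the position of [m], then [n], [m] and
     [w]. The sets 0 to 3 are [L'], [H], [S] and [Z]. *)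
  pose (values A := ex_le (Var 2) (ex_le (Var 3)
    (rel 1 (Var 3) (Var 1) && rel 1 (Var 2) (Var 0) && A))%form).
  pose (order := (rel 2 (Var 1) (Var 0) && Not (Eq (Var 1) (Var 0)) ||
    Eq (Var 1) (Var 0) && (Mem (Var 3) 3 && Not (Mem (Var 2) 3) ||
      ((Mem (Var 3) 3 ==> Mem (Var 2) 3) && (Mem (Var 2) 3 ==> Mem (Var 3) 3)) &&
      Not (Lt (Var 2) (Var 3))))%form).
  pose (s := scons L' (scons H (scons S (fun _ => Z)))).
  assert (Horder : Delta0 order) by repeat constructor.
  assert (Hvalues : forall A, Delta0 A -> Delta0 (values A)).
  { intros A HA; unfold values; do 2 apply Delta0_ex_le.
    apply Delta0_and; [repeat constructor|exact HA]. }
  assert (sat_values : forall A m n w e, mem M m L' -> mem M n L' ->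
    sat M (scons n (scons m (scons w e))) s (values A) <->
    (h m < w + 1 /\ h n < w + 1) /\
      sat M (scons (h n) (scons (h m) (scons n (scons m (scons w e))))) s A).
  { intros A m n w e Hm Hn; unfold values; rewrite sat_ex_le.
    setoid_rewrite sat_ex_le; setoid_rewrite sat_And; setoid_rewrite sat_And.
    split.
    - intros (u & Hu & v & Hv & [Hmu Hnv] & HA).
      apply (Hh m Hm u) in Hmu; apply (Hh n Hn v) in Hnv; subst u v; auto.
    - intros [[Hu Hv] HA]. exists (h m); split; [exact Hu|].
      exists (h n); split; [exact Hv|]. split; [|exact HA].
      split; apply Hh; auto. }
  assert (sat_order : forall m n u v e,
    sat M (scons v (scons u (scons n (scons m e)))) s order <->
    (strict_rel (rel_mem S) u v \/
      u = v /\ endpoint_le (fun x => mem M x Z) m n)).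
  { intros m n u v e; unfold order; rewrite sat_sem; reflexivity. }
  assert (bound : forall x y, x < pair x y + 1 /\ y < pair x y + 1).
  { intros x y; split; [apply lt_succ_pair_l|apply lt_succ_pair_r]. }
  apply (relation_comprehension _
    (Mem (Var 1) 0 && Mem (Var 0) 0 && values order)%form
    (Mem (Var 1) 0 && Mem (Var 0) 0 && Not (values (Not order)))%form s).
  - apply Delta0_and; [repeat constructor|auto].
  - apply Delta0_and; [repeat constructor|auto using Delta0_not].
  - intros m n z e; setoid_rewrite sat_And; setoid_rewrite sat_And. split.
    (* The pair serves as a common bound for the two positions. *)
    + intros [[Hm Hn] K]. exists (pair (h m) (h n)).
      split; [now split|]. apply sat_values; auto. split; [apply bound|].
      now apply sat_order.
    + intros (w & [Hm Hn] & K). apply sat_values in K as [_ K]; auto.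
      apply sat_order in K. now split; [split|].
  - intros m n z e; setoid_rewrite sat_And; setoid_rewrite sat_And. split.
    + intros [[Hm Hn] K] w. split; [now split|]. intros K'.
      apply sat_values in K' as [_ K']; auto. now apply K', sat_order.
    + intros K. destruct (K 0) as [[Hm Hn] _]. split; [now split|].
      destruct (K (pair (h m) (h n))) as [_ K'].
      apply NNPP; intros HN; apply K'. apply sat_values; auto.
      split; [apply bound|]. intros KO; apply HN. now apply sat_order in KO.
Qed.

End Refinement.

Lemma refinement P R L S F0 F1 :
  is_linear_order L S -> is_function P L F0 -> is_function P L F1 ->
  is_c1 P S F0 F1 -> is_c2 P R S F0 F1 -> is_c5 P S F0 F1 ->
  exists L' S' G0 G1,
    is_linear_order L' S' /\ is_function P L' G0 /\ is_function P L' G1 /\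
    is_c1 P S' G0 G1 /\ is_c2 P R S' G0 G1 /\ is_c4 P G0 G1 /\ is_c5 P S' G0 G1.
Proof.
  intros HLS HF0 HF1 H1 H2 H5.
  apply is_linear_order_iff in HLS as [_ HS].
  apply is_function_graph in HF0 as [f0 Hf0], HF1 as [f1 Hf1].
  assert (H1' : forall p, mem M p P -> rel_mem S (f0 p) (f1 p)).
  { intros p Hp; generalize (H1 p Hp).
    apply at_values_iff; [now apply Hf0|now apply Hf1]. }
  assert (H2' : forall p q, mem M p P -> mem M q P ->
    strict_rel (rel_mem R) p q <-> strict_rel (rel_mem S) (f1 p) (f0 q)).
  { intros p q Hp Hq; rewrite (H2 p Hp q Hq).
    apply at_values_iff; [now apply Hf1|now apply Hf0]. }
  assert (H5' : forall p q, mem M p P -> mem M q P ->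
    strict_rel (rel_mem S) (f0 p) (f0 q) <-> strict_rel (rel_mem S) (f1 p) (f1 q)).
  { intros p q Hp Hq.
    rewrite <- (at_values_iff F0 p F0 q _ (f0 p) (f0 q)); try now apply Hf0.
    rewrite <- (at_values_iff F1 p F1 q _ (f1 p) (f1 q)); try now apply Hf1.
    now apply H5. }
  clear H1 H2 H5.
  (* In a linear order, equality means strict inequality in neither direction, and (c5) transfers
     both directions. *)
  assert (Heq : forall p q, mem M p P -> mem M q P -> f0 p = f0 q <-> f1 p = f1 q).
  { intros p q Hp Hq. generalize (H5' p q Hp Hq) (H5' q p Hq Hp).
    destruct (Hf0 p Hp) as [Ap _], (Hf0 q Hq) as [Aq _],
      (Hf1 p Hp) as [Bp _], (Hf1 q Hq) as [Bq _].
    generalize (lin_total _ _ HS _ _ Ap Aq) (lin_total _ _ HS _ _ Bp Bq).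
    unfold strict_rel; intros [?|?] [?|?]; split; intros E; try rewrite E in *;
      apply NNPP; intros N; generalize (not_eq_sym N); tauto. }
  destruct (left_endpoints P) as [Z HZ], (endpoints P) as [L' HL'],
    (endpoint_map P Zero 0) as [G0 HG0], (endpoint_map P One 1) as [G1 HG1],
    (endpoint_position F0 F1) as [H HH]; try reflexivity.
  assert (HZ' : forall p b, mem M (pair p b) Z <-> mem M p P /\ b = 0)
    by exact (rel_mem_pair _ _ HZ).
  assert (HL0 : forall p, mem M p P -> mem M (pair p 0) L').
  { intros p Hp; apply HL'; eauto 6. }
  assert (HL1 : forall p, mem M p P -> mem M (pair p 1) L').
  { intros p Hp; apply HL'; eauto 6. }
  assert (H01 : forall p q, pair p 0 <> pair q 1).
  { intros p q E; apply pair_inj in E as [_ E]; now apply one_neq_zero. }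
  assert (HH0 : forall p, mem M p P -> forall u, rel_mem H (pair p 0) u <-> u = f0 p).
  { intros p Hp u. rewrite HH, <- (proj2 (Hf0 p Hp)). split.
    - intros [(q & _ & E & K)|(q & _ & E & K)]; [|now apply H01 in E].
      now apply pair_inj in E as [<- _].
    - intros K; left; exists p; split; [apply lt_succ_pair_l|now split]. }
  assert (HH1 : forall p, mem M p P -> forall u, rel_mem H (pair p 1) u <-> u = f1 p).
  { intros p Hp u. rewrite HH, <- (proj2 (Hf1 p Hp)). split.
    - intros [(q & _ & E & K)|(q & _ & E & K)]; [symmetry in E; now apply H01 in E|].
      now apply pair_inj in E as [<- _].
    - intros K; right; exists p; split; [apply lt_succ_pair_l|now split]. }
  assert (Hex : forall m, exists u, mem M m L' ->
    mem M u L /\ forall u', rel_mem H m u' <-> u' = u).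
  { intros m. destruct (classic (mem M m L')) as [Hm|Hm]; [|now exists 0].
    apply HL' in Hm as (p & b & -> & Hp & [->| ->]).
    - exists (f0 p); intros _; split; [now apply Hf0|now apply HH0].
    - exists (f1 p); intros _; split; [now apply Hf1|now apply HH1]. }
  destruct (choice _ Hex) as [h Hh]; clear Hex.
  assert (h0 : forall p, mem M p P -> h (pair p 0) = f0 p).
  { intros p Hp. now apply HH0, Hh; auto. }
  assert (h1 : forall p, mem M p P -> h (pair p 1) = f1 p).
  { intros p Hp. now apply HH1, Hh; auto. }
  destruct (refined_order S L' H Z h) as [S' HS'a].
  { intros m Hm; now apply Hh. }
  assert (HS' := rel_mem_pair _ _ HS'a).
  assert (HG0' : forall p, mem M p P -> forall y, rel_mem G0 p y <-> y = pair p 0).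
  { intros p Hp y; rewrite (rel_mem_pair _ _ HG0); tauto. }
  assert (HG1' : forall p, mem M p P -> forall y, rel_mem G1 p y <-> y = pair p 1).
  { intros p Hp y; rewrite (rel_mem_pair _ _ HG1); tauto. }
  assert (same : forall p q b, mem M p P -> mem M q P ->
    endpoint_le (fun x => mem M x Z) (pair p b) (pair q b) <-> ~ q < p).
  { intros p q b Hp Hq; unfold endpoint_le; rewrite !HZ', pair_lt_iff; tauto. }
  assert (pair_neq : forall p q b, pair p b <> pair q b <-> p <> q).
  { intros p q b; split; [congruence|]. intros N E; now apply pair_inj in E. }
  exists L', S', G0, G1. split; [|split; [|split; [|split; [|split; [|split]]]]].
  - apply is_linear_order_iff; split.
    + intros z Hz. apply HS'a in Hz as (m & n & -> & [Hm Hn] & _). eauto 6.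
    + apply (linear_on_ext _ (fun m n => strict_rel (rel_mem S) (h m) (h n) \/
        h m = h n /\ endpoint_le (fun x => mem M x Z) m n)).
      * intros m n Hm Hn; rewrite HS'; tauto.
      * apply lexicographic_linear with (Y := fun x => mem M x L);
          [exact HS|intros m Hm; now apply Hh|].
        apply (linear_on_subset (fun _ => True)); [auto|apply endpoint_le_linear].
  - now apply (graph_is_function _ _ _ (fun p => pair p 0)).
  - now apply (graph_is_function _ _ _ (fun p => pair p 1)).
  - intros p Hp. rewrite (at_values_iff _ _ _ _ _ (pair p 0) (pair p 1)); auto.
    rewrite HS', h0, h1 by assumption. split; [auto|].
    (* A degenerate interval is a tie, decided by placing its left endpoint first. *)
    destruct (classic (f0 p = f1 p)) as [E|N].
    + right; split; [exact E|left]. rewrite !HZ'. generalize one_neq_zero; tauto.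
    + left; split; auto.
  (* A tie never puts a right endpoint before a left one, so here the new strict order is that of
     the positions. *)
  - intros p Hp q Hq. rewrite (at_values_iff _ _ _ _ _ (pair p 1) (pair q 0)); auto.
    rewrite (H2' p q Hp Hq). unfold strict_rel at 2.
    rewrite HS', h0, h1 by assumption. unfold endpoint_le; rewrite !HZ'.
    generalize one_neq_zero (not_eq_sym (H01 q p)) (HL0 q Hq) (HL1 p Hp); tauto.
  - intros p Hp q Hq.
    rewrite (at_values_iff G0 p G0 q _ (pair p 0) (pair q 0)),
      (at_values_iff G1 p G1 q _ (pair p 1) (pair q 1)),
      (at_values_iff G0 p G1 q _ (pair p 0) (pair q 1)),
      (at_values_iff G1 p G0 q _ (pair p 1) (pair q 0)); auto.
    rewrite !pair_neq. generalize (H01 p q) (not_eq_sym (H01 q p)); tauto.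
  - intros p Hp q Hq.
    rewrite (at_values_iff G0 p G0 q _ (pair p 0) (pair q 0)),
      (at_values_iff G1 p G1 q _ (pair p 1) (pair q 1)); auto.
    unfold strict_rel at 1 2.
    (* Rewriting left positions into right ones by (c5) and [Heq] makes both sides the same
       comparison, with ties broken by [p] and [q]. *)
    rewrite !HS', !h0, !h1, !same, !pair_neq, H5', Heq by assumption.
    generalize (HL0 p Hp) (HL0 q Hq) (HL1 p Hp) (HL1 q Hq); tauto.
Qed.

End Arithmetic.

(* Set variable 1 is P and set variable 0 is its order relation. *)
Theorem theorem6p15 :
  provable RCA0
    (AllS (AllS
      (partial_order 1 0 ==>
       proper_closed_interval_order 1 0 ==>
       proper_distinguishing_interval_order 1 0)))%form.
Proof.
  apply completeness; intros M HM e r P R _ H.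
  unfold proper_closed_interval_order in H.
  apply sat_ExS in H as [L H]; apply sat_ExS in H as [S H].
  apply sat_ExS in H as [F0 H]; apply sat_ExS in H as [F1 H].
  rewrite !sat_And, sat_linear_order, !sat_function, sat_c1, sat_c2, sat_c5 in H.
  destruct H as [[[[[HL HF0] HF1] H1] H2] H5].
  destruct (refinement M HM r P R L S F0 F1) as
    (L' & S' & G0 & G1 & HL' & HG0 & HG1 & K1 & K2 & K4 & K5); auto.
  unfold proper_distinguishing_interval_order.
  apply sat_ExS; exists L'; apply sat_ExS; exists S'.
  apply sat_ExS; exists G0; apply sat_ExS; exists G1.
  rewrite !sat_And, sat_linear_order, !sat_function, sat_c1, sat_c2, sat_c4, sat_c5.
  auto 10.
Qed.
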